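(* Let $d\ge 2$, let $\kappa$ be a regular Borel probability measure on $\mathbb{S}_{d-1}$, let $T\in\mathbb{T}^d$ and let $(Y_t^{(T)})_{t\ge 0}$ be the splitting process with direction distribution $\kappa$ and initial tessellation $Y_0^{(T)}=T$. For $t\ge 0$ put $Z_t^{(T)}:=\bigcup_{c\in Y_t^{(T)}}\partial c$ and, for closed $C\subset\mathbb{S}^d$, $U_t^{(T)}(C):=\mathbf{P}(Z_t^{(T)}\cap C=\emptyset)$. (a) If $C\in\mathbb{P}^d$ is a spherical polytope which is contained in the interior of precisely one cell of $T$, then $$U_t^{(T)}(C)=\exp\big(-\kappa(\mathbb{S}_{d-1}\langle C\rangle)\,t\big),\qquad t\ge 0,$$ independently of $T$. (b) If $\kappa$ is absolutely continuous with respect to $\nu_{d-1}$, then the same relation holds for all closed connected sets $C\subset\mathbb{S}^d$ satisfying $C\subset\operatorname{int}(c)$ for some $c\in T$. (c) In particular, if $\kappa=\nu_{d-1}$ and $C=\overline{xy}$ is a spherical segment connecting $x,y\in\mathbb{S}^d$ with length $\ell(x,y)\le\pi$ and $\overline{xy}\subset\operatorname{int}(c)$ for some $c\in T$, then $$U_t^{(T)}(\overline{xy})=\exp\Big(-\frac1\pi\,\ell(x,y)\,t\Big),\qquad t\ge 0.$$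
   Context: $\mathbb{S}^d$ is the unit sphere in $\mathbb{R}^{d+1}$, with geodesic distance $\ell(x,y)=\arccos\langle x,y\rangle$; interior $\operatorname{int}$ and boundary $\partial$ are taken in $\mathbb{S}^d$. A spherical polytope is the intersection of $\mathbb{S}^d$ with a polyhedral cone, i.e. with an intersection of finitely many (possibly zero) closed half-spaces of $\mathbb{R}^{d+1}$ having the origin in their boundaries; $\mathbb{P}^d$ is the set of non-empty spherical polytopes (it includes $\mathbb{S}^d$, closed half-spheres and great subspheres), with the Borel $\sigma$-field of the Hausdorff distance. A tessellation of $\mathbb{S}^d$ is a finite set $T$ of $d$-dimensional spherical polytopes (its cells) with pairwise disjoint interiors and union $\mathbb{S}^d$; $\mathbb{T}^d$ is the set of all tessellations, with the $\sigma$-field generated by the maps $T\mapsto |T\cap B|$, $B\subset\mathbb{P}^d$ Borel. $\mathbb{S}_{d-1}$ is the (compact) space of great hyperspheres, i.e. intersections of $\mathbb{S}^d$ with $d$-dimensional linear subspaces of $\mathbb{R}^{d+1}$, and $\nu_{d-1}$ is its unique rotation invariant Borel probability measure. For $S\in\mathbb{S}_{d-1}$, $S^+,S^-$ are the two closed half-spheres bounded by $S$. For $B\subset\mathbb{S}^d$: $\mathbb{S}_{d-1}[B]:=\{S:S\cap\operatorname{int}(B)\ne\emptyset\}$ and $\mathbb{S}_{d-1}\langle B\rangle:=\{S:S\cap B\neq\emptyset\}$. A Borel measure $\kappa$ on $\mathbb{S}_{d-1}$ is regular if $\kappa(\{S:e\in S\})=0$ for every $e\in\mathbb{S}^d$.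 For $c\in T\in\mathbb{T}^d$ and $S\in\mathbb{S}_{d-1}[c]$ put $\oslash(c,S,T):=(T\setminus\{c\})\cup\{c\cap S^+,c\cap S^-\}$. The splitting process with direction distribution $\kappa$ and initial tessellation $T_0$ is the continuous-time pure jump Markov process on $\mathbb{T}^d$ started at $T_0$ at time $0$ with generator $(\mathcal{A}f)(T)=\sum_{c\in T}\int_{\mathbb{S}_{d-1}[c]}[f(\oslash(c,S,T))-f(T)]\,\kappa(\mathrm{d}S)$ for bounded measurable $f:\mathbb{T}^d\to\mathbb{R}$. Equivalently: independently of each other, each existing cell $c$ has an exponential lifetime with parameter $\kappa(\mathbb{S}_{d-1}[c])$, at the end of which it is split into $c\cap S^+$ and $c\cap S^-$ by a random $S$ with distribution $\kappa(\,\cdot\,\cap\mathbb{S}_{d-1}[c])/\kappa(\mathbb{S}_{d-1}[c])$. *)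

(* Defs.v *)
From HB Require Import structures.
From mathcomp Require Import all_boot all_order all_algebra.
From mathcomp Require Import all_classical all_reals all_analysis.

Set Implicit Arguments.
Unset Strict Implicit.
Unset Printing Implicit Defensive.
Import Order.TTheory GRing.Theory Num.Theory.
Import numFieldNormedType.Exports.
Local Open Scope classical_set_scope.
Local Open Scope ring_scope.

Section Sphere.
Variables (R : realType) (d : nat).

Definition dotv (x y : 'rV[R]_d.+1) : R := \sum_i x 0 i * y 0 i.

(* Used as a type through the coercion [set_type], the sphere carries the
   topology induced by R^(d+1): interiors and closures of a [set sphere]
   are relative to the sphere. *)
Definition sphere : set 'rV[R]_d.+1 := [set x | dotv x x = 1].

Implicit Types (A B C : set sphere) (x y : sphere) (u : 'rV[R]_d.+1).

Definition geod x y : R := acos (dotv (\val x) (\val y)).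

Definition bd B : set sphere := closure B `\` B°.

(* Only meant for nonempty sets; [geod] is bounded, so that all infima and
   suprema are then genuine. *)
Definition hausdorff_dist A B : R :=
  Num.max (sup [set inf [set geod x y | y in B] | x in A])
          (sup [set inf [set geod x y | x in A] | y in B]).

Definition hausdorff_open (X : Type) (f : X -> set sphere) : set (set X) :=
  [set U | forall p, U p ->
     exists2 e : R, 0 < e & forall q, hausdorff_dist (f p) (f q) < e -> U q].

Definition half_sphere u : set sphere := [set x | 0 <= dotv u (\val x)].

Definition is_polytope C : Prop :=
  C !=set0 /\
  exists us : seq 'rV[R]_d.+1,
    0 \notin us /\ C = [set x | forall u, u \in us -> half_sphere u x].

(* [L] contains the linear hull of [C]. *)
Definition in_subspace C (L : {vspace 'rV[R]_d.+1}) : Prop :=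
  forall x, C x -> \val x \in L.

(* The dimension of a spherical polytope is that of its linear hull minus 1. *)
Definition has_dim C (k : nat) : Prop :=
  (exists2 L, in_subspace C L & \dim L = k.+1) /\
  (forall L, in_subspace C L -> (k < \dim L)%N).

Definition is_hypersphere C : Prop :=
  exists2 L : {vspace 'rV[R]_d.+1}, \dim L = d & C = [set x | \val x \in L].

Definition rotate (O : 'M[R]_d.+1) C : set sphere :=
  [set x | exists2 y, C y & \val x = \val y *m O].

(* The unit vector v is the direction in which the segment leaves x.  For
   y = - x every great half-circle from x to y is a segment. *)
Definition spherical_segment x y C : Prop :=
  exists v : 'rV[R]_d.+1,
    [/\ dotv v v = 1, dotv (\val x) v = 0,
        \val y = cos (geod x y) *: \val x + sin (geod x y) *: v &
        C = [set z | exists2 s : R, 0 <= s <= geod x y &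
                                \val z = cos s *: \val x + sin s *: v]].

Record polytope := Polytope {
  polytope_set :> set sphere;
  _ : `[< is_polytope polytope_set >] }.

Record hypersphere := Hypersphere {
  hypersphere_set :> set sphere;
  _ : `[< is_hypersphere hypersphere_set >] }.

HB.instance Definition _ := [isSub for polytope_set].
HB.instance Definition _ := [Choice of polytope by <:].
HB.instance Definition _ := [isSub for hypersphere_set].
HB.instance Definition _ := [Choice of hypersphere by <:].

Definition is_tessellation (T : set polytope) : Prop :=
  [/\ finite_set T,
      forall c, T c -> has_dim c d,
      forall c c', T c -> T c' -> c <> c' -> c° `&` c'° = set0 &
      \bigcup_(c in T) (c : set sphere) = setT].

Record tessellation := Tessellation {
  cells :> set polytope;
  _ : `[< is_tessellation cells >] }.

HB.instance Definition _ := [isSub for cells].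
HB.instance Definition _ := [Choice of tessellation by <:].

Definition hits B : set hypersphere :=
  [set S : hypersphere | (S : set sphere) `&` B !=set0].

Definition hits_int B : set hypersphere := hits B°.

Lemma dotv_delta u i : dotv (delta_mx 0 i) u = u 0 i.
Proof.
rewrite /dotv (bigD1 i)//= mxE !eqxx mul1r big1 ?addr0// => j ji.
by rewrite mxE (negPf ji) andbF mul0r.
Qed.

Lemma sphere_delta i : sphere (delta_mx 0 i).
Proof. by rewrite /sphere/= dotv_delta mxE !eqxx. Qed.

Definition pole i : sphere := SigSub (mem_set (sphere_delta i)).

Lemma is_polytope_setT : is_polytope setT.
Proof.
split; first by exists (pole 0).
by exists [::]; split=> //; apply/esym/seteqP; split.
Qed.

Lemma has_dim_setT : has_dim setT d.
Proof.
have dimf : \dim {: 'rV[R]_d.+1} = d.+1 by rewrite dimvf /dim /= mul1n.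
split; first by exists fullv => // x _; exact: memvf.
move=> L sL; apply: (@leq_trans (\dim {: 'rV[R]_d.+1})); first by rewrite dimf.
apply: dimvS; apply/subvP => x _.
rewrite (row_sum_delta x); apply: memv_suml => i _; apply: memvZ.
exact: (sL (pole i)).
Qed.

Lemma is_hypersphere_ex : is_hypersphere
  [set x | \val x \in (<[\val (pole 0%R)]>^C)%VS].
Proof.
exists (<[\val (pole 0%R)]>^C)%VS => //.
rewrite dimv_compl dimvf /dim /= mul1n dim_vline.
case: eqP => [/(congr1 (fun M : 'rV[R]_d.+1 => M 0 0))|_]; last first.
  by rewrite subn1.
by rewrite !mxE eqxx => /eqP; rewrite oner_eq0.
Qed.

Definition polytope_setT : polytope := Polytope (asboolT is_polytope_setT).

Lemma is_tessellation_setT : is_tessellation [set polytope_setT].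
Proof.
split.
- exact: finite_set1.
- by move=> c ->; exact: has_dim_setT.
- by move=> c c' -> ->.
- by rewrite bigcup_set1.
Qed.

HB.instance Definition _ := isPointed.Build polytope polytope_setT.
HB.instance Definition _ :=
  isPointed.Build hypersphere (Hypersphere (asboolT is_hypersphere_ex)).
HB.instance Definition _ :=
  isPointed.Build tessellation (Tessellation (asboolT is_tessellation_setT)).

HB.instance Definition _ := Measurable.copy polytope
  (g_sigma_algebraType (hausdorff_open polytope_set)).
HB.instance Definition _ := Measurable.copy hypersphere
  (g_sigma_algebraType (hausdorff_open hypersphere_set)).

(* The sigma-field generated by the maps T |-> |T /\ B|. *)
Definition counting_events : set (set tessellation) :=
  [set E | exists (B : set polytope) n, measurable B /\
     E = [set T : tessellation | ((T : set polytope) `&` B #= `I_n)%card]].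

HB.instance Definition _ := Measurable.copy tessellation
  (g_sigma_algebraType counting_events).

(* The two closed half-spheres bounded by S. *)
Definition sides (S : hypersphere) : set (set sphere) :=
  [set H | exists u, [/\ u != 0,
     (S : set sphere) = [set x | dotv u (\val x) = 0] & H = half_sphere u]].

Definition split_cells (c : polytope) (S : hypersphere) (T : set polytope) :
    set polytope :=
  (T `\ c) `|`
  [set c' : polytope | exists2 H, sides S H &
     (c' : set sphere) = (c : set sphere) `&` H].

(* For c in T and S in [hits_int c], [split_cells c S T] is a tessellation, so
   the default value of [insubd] plays no role in [generator] below. *)
Definition split_cell (c : polytope) (S : hypersphere) (T : tessellation) :
  tessellation := insubd T (split_cells c S T).

Definition skeleton (T : tessellation) : set sphere :=
  \bigcup_(c in (T : set polytope)) bd c.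

End Sphere.
Arguments sphere : clear implicits.

Section SplittingProcess.
Variables (R : realType) (d : nat).
Local Notation polytope := (polytope R d).
Local Notation hypersphere := (hypersphere R d).
Local Notation tessellation := (tessellation R d).

Definition regular (mu : set hypersphere -> \bar R) : Prop :=
  forall e : sphere R d, mu [set S : hypersphere | (S : set _) e] = 0%E.

Definition rotation_invariant (mu : set hypersphere -> \bar R) : Prop :=
  forall O : 'M[R]_d.+1, O *m O^T = 1%:M -> \det O = 1 ->
  forall B : set hypersphere, measurable B ->
    mu [set S : hypersphere |
         exists2 S' : hypersphere, B S' & (S : set _) = rotate O S'] = mu B.

Definition generator (kappa : probability hypersphere R)
    (f : tessellation -> R) (T : tessellation) : R :=
  \sum_(c \in (T : set polytope))
    \int[kappa]_(S in hits_int c) (f (split_cell c S T) - f T).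

Definition transition_semigroup
    (p : R -> R.-pker tessellation ~> tessellation) : Prop :=
  (forall T (B : set tessellation), measurable B -> p 0 T B = \d_T B) /\
  (forall s t : R, 0 <= s -> 0 <= t -> forall T (B : set tessellation),
     measurable B -> p (s + t) T B = (\int[p s T]_T' p t T' B)%E).

(* The jump rates are unbounded on the space of all tessellations, so the
   derivative at time 0 is taken pointwise. *)
Definition has_generator (p : R -> R.-pker tessellation ~> tessellation)
    (A : (tessellation -> R) -> tessellation -> R) : Prop :=
  forall f : tessellation -> R, measurable_fun setT f ->
    (exists M : R, forall T, `|f T| <= M) ->
  forall T, h^-1 * (\int[p h T]_T' f T' - f T) @[h --> 0^'+] --> A f T.

Section Process.
Context {dO : measure_display} {Omega : measurableType dO}.
Variables (P : probability Omega R) (Y : R -> Omega -> tessellation).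

Definition past (s : R) : set (set Omega) :=
  <<s [set E | exists (r : R) (B : set tessellation),
    [/\ 0 <= r <= s, measurable B & E = Y r @^-1` B]] >>.

Definition markov_process
    (p : R -> R.-pker tessellation ~> tessellation) : Prop :=
  (forall t : R, 0 <= t -> measurable_fun setT (Y t)) /\
  (forall s t : R, 0 <= s -> 0 <= t ->
     forall E (B : set tessellation), past s E -> measurable B ->
     P (E `&` Y (s + t) @^-1` B) = (\int[P]_(w in E) p t (Y s w) B)%E).

(* By compactness of [0, t]: almost surely, the path is right-continuous and
   piecewise constant with finitely many jumps in every bounded interval. *)
Definition pure_jump : Prop :=
  {ae P, forall w, forall t : R, 0 <= t -> exists2 e : R, 0 < e &
     (forall s : R, t <= s < t + e -> Y s w = Y t w) /\
     (exists T, forall s : R, 0 <= s -> t - e < s < t -> Y s w = T)}.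

Definition splitting_process (kappa : probability hypersphere R)
    (T0 : tessellation) : Prop :=
  [/\ {ae P, forall w, Y 0 w = T0}, pure_jump &
      exists p, [/\ transition_semigroup p, has_generator p (generator kappa) &
                    markov_process p]].

Definition avoid_proba (t : R) (C : set (sphere R d)) : \bar R :=
  P [set w | skeleton (Y t w) `&` C = set0].

End Process.
End SplittingProcess.

(* Main.v *)
(** For a closed connected non-empty set C, the skeleton of a tessellation T
    misses C exactly when C lies in the interior of one cell of T; let I be the
    set of these T.  Splitting a cell leaves I only when the hypersphere hits C,
    and never enters I, so the indicator of I is an eigenfunction of the
    generator, with eigenvalue -lambda for lambda = kappa(hits C).  Hence
    e^(-lambda t) 1_I and p_t(., I) both solve the backward equation.  As the
    total jump rate is at most the number n of cells, which grows by at most two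
    at each jump, their difference is bounded by e^(2t) (n+1)/(n+1+m) for every
    m, by induction on m, and therefore vanishes.

    A spherical polytope is connected unless it is a pair of antipodal points,
    and regularity makes the two points almost surely avoided.

    For (c), rotations in the plane of the segment make the measure of the
    hyperspheres hitting an arc additive in its length, and every hypersphere
    hits a half-circle. *)
Require Import Defs.
From HB Require Import structures.
From mathcomp Require Import all_boot all_order all_algebra.
From mathcomp Require Import all_classical all_reals all_analysis.
From mathcomp Require Import measurable_realfun finmap ring lra.
Set Implicit Arguments.
Unset Strict Implicit.
Unset Printing Implicit Defensive.
Import Order.TTheory GRing.Theory Num.Theory.
Import numFieldNormedType.Exports.
Local Open Scope classical_set_scope.
Local Open Scope ring_scope.

(** * The sphere, its topology and polytopes *)

(** The generator is known only pointwise and at time 0, with total rates that are unbounded in T,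
    so no Gronwall estimate in sup norm and no two-sided derivative in t is at hand. Applied to
    p_t(., I) it yields right derivatives alone; left continuity is recovered from p_h(T, {T}) -> 1,
    and this is why single tessellations, hence single polytopes, are shown to be Borel. That I is
    Borel rests on a stability: a closed C inside the interior of a polytope stays there under small
    Hausdorff perturbations of the polytope. The bound e^(2t) (n+1)/(n+1+m) has the shape of
    Markov's inequality: with jump rate at most n+1 and at most two more cells per jump, n+1 grows
    in mean by a factor of at most e^(2t), and it is compared with n+1+m, its size after m splits.
    It tends to 0 as m grows, though not uniformly in n. The integrals over hyperspheres in the
    generator are only compared with integrals of functions affine in the indicator of [hits C]. *)

Section DotProduct.
Variables (R : realType) (d : nat).
Implicit Types (u v w : 'rV[R]_d.+1) (x y z : sphere R d).

Lemma dotvC u v : dotv u v = dotv v u.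
Proof. by apply: eq_bigr => i _; rewrite mulrC. Qed.

Lemma dotvDr u v w : dotv u (v + w) = dotv u v + dotv u w.
Proof. by rewrite -big_split; apply: eq_bigr => i _; rewrite mxE mulrDr. Qed.

Lemma dotvZr a u v : dotv u (a *: v) = a * dotv u v.
Proof.
by rewrite /dotv mulr_sumr; apply: eq_bigr => i _; rewrite mxE mulrCA.
Qed.

Lemma dotvDl u v w : dotv (u + v) w = dotv u w + dotv v w.
Proof. by rewrite !(dotvC _ w) dotvDr. Qed.

Lemma dotvZl a u v : dotv (a *: u) v = a * dotv u v.
Proof. by rewrite !(dotvC _ v) dotvZr. Qed.

Lemma dotvNl u v : dotv (- u) v = - dotv u v.
Proof. by rewrite -scaleN1r dotvZl mulN1r. Qed.

Lemma dotvNr u v : dotv u (- v) = - dotv u v.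
Proof. by rewrite -scaleN1r dotvZr mulN1r. Qed.

Lemma dot0v v : dotv 0 v = 0.
Proof. by rewrite -(scale0r 0) dotvZl mul0r. Qed.

Definition dotvE := (dotvDr, dotvDl, dotvZr, dotvZl, dotvNr, dotvNl).

Lemma dotv_ge0 u : 0 <= dotv u u.
Proof. by apply: sumr_ge0 => i _; rewrite -expr2 sqr_ge0. Qed.

Lemma sqr_coord_le u i : u 0 i ^+ 2 <= dotv u u.
Proof.
rewrite /dotv (bigD1 i)//= expr2 lerDl; apply: sumr_ge0 => j _.
by rewrite -expr2 sqr_ge0.
Qed.

Lemma dotv_eq0 u : (dotv u u == 0) = (u == 0).
Proof.
apply/idP/eqP => [/eqP u0|->]; last by rewrite dot0v.
apply/rowP => i; rewrite mxE; apply/eqP; rewrite -sqrf_eq0 eq_le sqr_ge0.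
by rewrite -[leRHS]u0 sqr_coord_le.
Qed.

Lemma dotv_gt0 u : u != 0 -> 0 < dotv u u.
Proof. by move=> u0; rewrite lt_def dotv_eq0 u0 dotv_ge0. Qed.

Lemma dotv_val x : dotv (\val x) (\val x) = 1.
Proof. exact: set_mem (valP x). Qed.

Lemma dotv_sqr_le u x : dotv u (\val x) ^+ 2 <= dotv u u.
Proof.
have := dotv_ge0 (u - dotv u (\val x) *: \val x).
by rewrite !dotvE dotv_val (dotvC _ u); nra.
Qed.

Lemma dotv_bound x y : -1 <= dotv (\val x) (\val y) <= 1.
Proof. by have := dotv_sqr_le (\val x) y; rewrite dotv_val; nra. Qed.

Lemma cos_geod x y : cos (geod x y) = dotv (\val x) (\val y).
Proof. by rewrite acosK// in_itv/= dotv_bound. Qed.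

Lemma geod_ge0 x y : 0 <= geod x y.
Proof. exact/acos_ge0/dotv_bound. Qed.

Lemma geod_lepi x y : geod x y <= pi.
Proof. exact/acos_lepi/dotv_bound. Qed.

Lemma geodC x y : geod x y = geod y x.
Proof. by rewrite /geod dotvC. Qed.

Lemma dotv_mx u v : dotv u v = (u *m v^T) 0 0.
Proof. by rewrite mxE; apply: eq_bigr => i _; rewrite mxE. Qed.

(* The default [pole 0] is only reached for [u = 0]. *)
Definition direction u : sphere R d :=
  insubd (pole R 0) ((Num.sqrt (dotv u u))^-1 *: u).

Lemma val_direction u :
  u != 0 -> \val (direction u) = (Num.sqrt (dotv u u))^-1 *: u.
Proof.
move=> u0; rewrite insubdK//; apply/mem_set; rewrite /sphere/=.
have s0 : Num.sqrt (dotv u u) != 0 by rewrite gt_eqF// sqrtr_gt0 dotv_gt0.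
move: (sqr_sqrtr (dotv_ge0 u)) s0; rewrite !dotvE.
by set s := Num.sqrt _ => <- s0; field.
Qed.

Lemma dotv_direction u v :
  v != 0 -> dotv u (\val (direction v)) = (Num.sqrt (dotv v v))^-1 * dotv u v.
Proof. by move=> v0; rewrite val_direction// dotvZr. Qed.

Lemma dotv_direction_ge0 u v :
  v != 0 -> (0 <= dotv u (\val (direction v))) = (0 <= dotv u v).
Proof.
by move=> v0; rewrite dotv_direction// pmulr_rge0// invr_gt0 sqrtr_gt0 dotv_gt0.
Qed.

Lemma dotv_direction_gt0 u v :
  v != 0 -> (0 < dotv u (\val (direction v))) = (0 < dotv u v).
Proof.
by move=> v0; rewrite dotv_direction// pmulr_rgt0// invr_gt0 sqrtr_gt0 dotv_gt0.
Qed.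

Lemma dotv_direction_eq0 u v :
  v != 0 -> (dotv u (\val (direction v)) == 0) = (dotv u v == 0).
Proof.
move=> v0; rewrite dotv_direction// mulf_eq0 invr_eq0 gt_eqF//.
by rewrite sqrtr_gt0 dotv_gt0.
Qed.

End DotProduct.

(** * Spherical caps as neighbourhoods; compactness *)

Section SphereTopology.
Variables (R : realType) (d : nat).
Implicit Types (u v w : 'rV[R]_d.+1) (x y z : sphere R d) (A C : set (sphere R d)).

Lemma continuous_dotv u : continuous (dotv u : 'rV[R]_d.+1 -> R).
Proof.
rewrite (_ : dotv u = \sum_i (fun v => u 0 i * v 0 i)); last first.
  by apply/funext => v; rewrite fct_sumE.
apply: (@big_rec _ (fun f : 'rV[R]_d.+1 -> R => continuous f)).
  exact: cst_continuous.
move=> i f _ cf v; apply: continuousD; last exact: cf.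
by apply: continuousM; [exact: cst_continuous|exact: coord_continuous].
Qed.

Lemma continuous_val : continuous (fun x => \val x).
Proof. exact: initial_continuous. Qed.

Lemma continuous_dotv_val u : continuous (fun x => dotv u (\val x)).
Proof.
move=> x; apply: (@continuous_comp _ _ _ (fun x => \val x) (dotv u)).
  exact: continuous_val.
exact: continuous_dotv.
Qed.

(** Caps form a base of neighbourhoods because the squared chord is 2 - 2<x,y>. Later estimates thus
    need inner products only, neither the induced topology nor [acos]. *)
Lemma nbhs_sphereP x A : nbhs x A <->
  exists2 e : R, 0 < e & forall y, 1 - e < dotv (\val x) (\val y) -> A y.
Proof.
split=> [[_ [[B oB <-] Bx BA]]|[e e0 eA]]; last first.
  have : 1 - e < dotv (\val x) (\val x) by rewrite dotv_val; lra.
  move=> /(cvgr_gt _ (@continuous_dotv_val (\val x) x)).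
  by apply: filterS => y; exact: eA.
have : nbhs (\val x) B by apply: open_nbhs_nbhs; split.
move=> /nbhs_ballP[e /= e0 eB]; exists (e ^+ 2 / 2); first by nra.
move=> y xy; apply: BA; apply: eB; split=> // i j; rewrite (ord1 i) /ball/= /ball_.
rewrite -ltr_sqr ?nnegrE// ?ltW// real_normK ?num_real//.
have := sqr_coord_le (\val x - \val y) j; rewrite !mxE.
move/le_lt_trans; apply; rewrite !dotvE !dotv_val (dotvC (\val y)).
by move: xy; lra.
Qed.

Lemma compact_sphereT : compact [set: sphere R d].
Proof.
have cS : compact (sphere R d).
  apply: bounded_closed_compact; last first.
    rewrite (_ : sphere R d = (fun v => dotv v v) @^-1` [set 1])//.
    apply: closed_comp => [v _|]; last exact: (@closed_eq _ (1 : R)).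
    rewrite (_ : (fun v => dotv v v) = \sum_i (fun v => v 0 i * v 0 i)).
      apply: (@big_rec _ (fun f : 'rV[R]_d.+1 -> R => {for v, continuous f})).
        exact: cst_continuous.
      move=> i f _ cf; apply: continuousD => //.
      by apply: continuousM; exact: coord_continuous.
    by apply/funext => w; rewrite fct_sumE.
  exists 1; split=> // M M1 v /= v1; apply: (le_trans _ (ltW M1)).
  rewrite /Num.norm/=; have [->//|/mx_norm_neq0[[i j] ->/=]] := eqVneq (mx_norm v) 0.
  have := sqr_coord_le v j.
  rewrite v1 (ord1 i) -(real_normK (num_real (v 0 j))).
  rewrite -[X in _ <= X -> _](expr1n _ 2).
  by rewrite ler_sqr ?nnegrE.
(* Compactness passes to the subtype: the image of F clusters at a point of the sphere in R^(d+1),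
   and since the topology is the induced one, F clusters at that point too. *)
move=> F PF _.
have : (fmap (fun x => \val x) F) (sphere R d).
  by apply: (@filterS _ F _ setT) => [x _|]; [exact: dotv_val|exact: filterT].
move=> /(cS _ (fmap_proper_filter _ PF))[p [Sp cp]].
exists (SigSub (mem_set Sp)); split=> // A B FA [_ [[B' oB <-] B'p B'B]].
have [||q [[y Ay <-] Bq]] := cp ((fun x => \val x) @` A) B'.
- by apply: (@filterS _ F _ A) => // y Ay; exists y.
- by apply: open_nbhs_nbhs; split.
by exists y; split=> //; exact: B'B.
Qed.

End SphereTopology.

(** * Geodesic and Hausdorff distances *)

Section Metric.
Variables (R : realType) (d : nat).
Implicit Types (u v w : 'rV[R]_d.+1) (x y z : sphere R d).
Implicit Types (A B C : set (sphere R d)).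

Lemma closed_lower_bound C (f : sphere R d -> R) : closed C -> continuous f ->
  (forall x, C x -> 0 < f x) -> exists2 m, 0 < m & forall x, C x -> m <= f x.
Proof.
move=> cC cf f0; have [->|C0] := eqVneq C set0; first by exists 1.
have kC : compact C.
  by rewrite -(setTI C); apply: compact_closedI => //; exact: compact_sphereT.
have [|c /set_mem Cc cP] := compact_EVT_min _ kC (continuous_subspaceT cf).
  exact/set0P.
by exists (f c); [exact: f0|move=> x /mem_set; exact: cP].
Qed.

Lemma cauchy_schwarz u v : dotv u v ^+ 2 <= dotv u u * dotv v v.
Proof.
have [->|v0] := eqVneq v 0; first by rewrite dotvC !dot0v expr0n/= mulr0.
have := dotv_ge0 (dotv v v *: u - dotv u v *: v).
rewrite !dotvE (dotvC v u); have := dotv_gt0 v0.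
set a := dotv u u; set b := dotv v v; set c := dotv u v => b0 h.
have : 0 <= b * (b * a - c ^+ 2) by lra.
by rewrite pmulr_rge0// subr_ge0 mulrC.
Qed.

Lemma dotv_lipschitz u x y :
  (dotv u (\val x) - dotv u (\val y)) ^+ 2 <=
  dotv u u * (2 - 2 * dotv (\val x) (\val y)).
Proof.
have := cauchy_schwarz u (\val x - \val y).
by rewrite !dotvE !dotv_val (dotvC (\val y)); lra.
Qed.

Lemma geod_small (e : R) : 0 < e ->
  exists2 r, 0 < r & forall x y, geod x y < r ->
    1 - e < dotv (\val x) (\val y).
Proof.
(* The minimum with 1 keeps the argument of [acos] in [-1, 1] however large e is. *)
move=> e0; exists (acos (1 - Num.min e 1)).
  by apply: acos_gt0; case: (leP e 1) => ?; lra.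
move=> x y; have e1 : -1 <= 1 - Num.min e 1 <= 1.
  by case: (leP e 1) => ?; lra.
rewrite -ltr_cos ?in_itv/= ?geod_ge0 ?geod_lepi ?acos_ge0 ?acos_lepi//.
rewrite acosK ?in_itv//= cos_geod; apply: le_lt_trans.
by case: (leP e 1) => ?; lra.
Qed.

Lemma inf_geod_lt A x (e : R) : A !=set0 ->
  inf [set geod x y | y in A] < e -> exists2 y, A y & geod x y < e.
Proof.
move=> [a Aa] /inf_lt[|_ [y Ay <-] ye]; last by exists y.
by exists (geod x a), a.
Qed.

Lemma hausdorff_dist_lt A B (e : R) : A !=set0 -> B !=set0 ->
  hausdorff_dist A B < e ->
  (forall x, A x -> exists2 y, B y & geod x y < e) /\
  (forall y, B y -> exists2 x, A x & geod x y < e).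
Proof.
have sup_ub (D E : set (sphere R d)) x : D x -> E !=set0 ->
    inf [set geod x y | y in E] <=
    sup [set inf [set geod x y | y in E] | x in D].
  move=> Dx [y Ey]; apply: ub_le_sup; last by exists x.
  exists pi => _ [z _ <-]; apply: (le_trans _ (geod_lepi z y)).
  apply: ge_inf; last by exists y.
  by exists 0 => _ [t _ <-]; exact: geod_ge0.
move=> A0 B0; rewrite /hausdorff_dist gt_max => /andP[h1 h2]; split=> [x Ax|y By].
  by apply: inf_geod_lt => //; apply: le_lt_trans h1; exact: sup_ub.
suff : inf [set geod y x | x in A] < e.
  by move=> /(inf_geod_lt A0)[x Ax xe]; exists x; rewrite 1?geodC.
apply: le_lt_trans h2.
have geod_sym z : [set geod z x | x in A] = [set geod x z | x in A].
  by apply: eq_imagel => x _; exact: geodC.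
under [X in sup X]eq_imagel do rewrite -geod_sym.
exact: sup_ub.
Qed.

End Metric.

(** * Hyperspheres and their normal vectors *)

Section Hyperspheres.
Variables (R : realType) (d : nat).
Implicit Types (u v w : 'rV[R]_d.+1) (x y z : sphere R d).
Implicit Types (A B C : set (sphere R d)) (S : hypersphere R d).

Fact dotv_is_linear u : linear (dotv u : 'rV[R]_d.+1 -> R^o).
Proof. by move=> a v w; rewrite dotvDr dotvZr. Qed.

HB.instance Definition _ u := GRing.isLinear.Build R 'rV[R]_d.+1 R^o _
  (dotv u : 'rV[R]_d.+1 -> R^o) (dotv_is_linear u).

Lemma orthogonal_subspace u : u != 0 ->
  exists2 L : {vspace 'rV[R]_d.+1},
    \dim L = d & forall v, (v \in L) = (dotv u v == 0).
Proof.
move=> u0; pose f := linfun (dotv u : 'rV[R]_d.+1 -> R^o).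
exists (lker f); last by move=> v; rewrite memv_ker lfunE.
have := limg_ker_dim f fullv; rewrite capfv dimvf /dim/= mul1n.
suff -> : \dim (f @: fullv) = 1%N by rewrite addn1 => -[].
apply/eqP; rewrite eqn_leq; apply/andP; split.
  by apply: (leq_trans (dimvS (subvf _))); rewrite dimvf.
rewrite lt0n dimv_eq0; apply/negP => /eqP f0.
have := memv_img f (memvf u); rewrite f0 memv0 lfunE/= => /eqP/eqP.
by rewrite dotv_eq0 (negPf u0).
Qed.

Lemma is_hypersphereP C : is_hypersphere C <->
  exists2 u, u != 0 & C = [set x | dotv u (\val x) = 0].
Proof.
split=> [[L dL ->]|[u u0 ->]]; last first.
  have [L dL LE] := orthogonal_subspace u0.
  by exists L => //; apply/seteqP; split=> x /=; rewrite LE => /eqP.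
(* The columns of [M] are a basis of L. Its rank is at most d, so its left kernel contains a nonzero
   u, which is orthogonal to L. *)
pose M : 'M[R]_(d.+1, d) := \matrix_(k, i) (vbasis L)`_i 0 k.
pose u := nz_row (kermx M).
have u0 : u != 0.
  rewrite nz_row_eq0 -mxrank_eq0 mxrank_ker -lt0n subn_gt0 ltnS.
  exact: rank_leq_col.
exists u => //; have [L' dL' L'E] := orthogonal_subspace u0.
suff -> : L = L' by apply/seteqP; split=> x /=; rewrite L'E => /eqP.
apply/eqP; rewrite eqEdim dL dL' leqnn andbT; apply/subvP => v.
rewrite -(span_basis (vbasisP L)) => /coord_span ->.
apply: memv_suml => i _; apply: memvZ; rewrite L'E; apply/eqP.
have /sub_kermxP/rowP : (u <= kermx M)%MS by exact: nz_row_sub.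
move=> /(_ (cast_ord dL i)); rewrite !mxE => uM; rewrite -[RHS]uM.
by apply: eq_bigr => k _; rewrite !mxE.
Qed.

Lemma hypersphereP S : exists2 u, u != 0 &
  (S : set (sphere R d)) = [set x | dotv u (\val x) = 0].
Proof. by case: S => C /= /asboolP/is_hypersphereP. Qed.

Lemma hypersphere_neq0 S : (0 < d)%N -> (S : set (sphere R d)) !=set0.
Proof.
case: S => C /= /asboolP[L dL ->] d0.
have v0 : vpick L != 0 by rewrite vpick0 -dimv_eq0 dL -lt0n.
by exists (direction (vpick L)); rewrite /= val_direction// memvZ// memv_pick.
Qed.

End Hyperspheres.

(** * Interiors and dimension of polytopes *)

Section Polytopes.
Variables (R : realType) (d : nat).
Implicit Types (u v w : 'rV[R]_d.+1) (x y z : sphere R d).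
Implicit Types (A B C : set (sphere R d)) (p q c : polytope R d).
Implicit Types us : seq 'rV[R]_d.+1.

Definition cone_trace us : set (sphere R d) :=
  [set x | forall u, u \in us -> half_sphere u x].

(** The squared sine of the angle between x and x + r w is r^2 (|w|^2 - <x,w>^2) / |x + r w|^2. The
    same s serves all x and all w of bounded norm; this uniformity is needed to compare nearby
    polytopes. *)
Lemma dotv_direction_near (e b : R) : 0 < e -> 0 <= b ->
  exists2 s : R, 0 < s <= 1 & forall r x w, 0 < r <= s -> dotv w w <= b ->
    \val x + r *: w != 0 /\
    1 - e < dotv (\val x) (\val (direction (\val x + r *: w))).
Proof.
(* The first bound gives |x + r w|^2 >= 9/16, the second r^2 (b+1) <= e/8; an inner product of at
   most 1 - e would force 9e/16 <= e/8. *)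
move=> e0 b0; exists (Num.min (1 / (2 * (b + 1))) (e / (4 * (b + 1)))).
  rewrite lt_min ge_min !divr_gt0 ?mulr_gt0 ?ltr_wpDl//=.
  by rewrite ler_pdivrMr ?mulr_gt0 ?ltr_wpDl//; apply/orP; left; lra.
move=> r x w /andP[r0]; rewrite le_min.
rewrite !ler_pdivlMr ?mulr_gt0 ?ltr_wpDl// => /andP[rb re] wb.
set z := \val x + _.
have zx : dotv (\val x) z = 1 + r * dotv (\val x) w.
  by rewrite /z !dotvE dotv_val.
have zz : dotv z z = 1 + 2 * r * dotv (\val x) w + r ^+ 2 * dotv w w.
  by rewrite /z !dotvE dotv_val (dotvC w); ring.
have := dotv_sqr_le w x; rewrite (dotvC w).
set a := dotv (\val x) w in zx zz *; set k := dotv w w in wb zz * => ak.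
have a1 : - (b + 1) <= 2 * a by have := sqr_ge0 (a + 1); lra.
have ra : - (1 / 4) <= r * a.
  have : 0 <= r * (2 * a + (b + 1)) by apply: mulr_ge0; lra.
  by lra.
have zz1 : 9 / 16 <= dotv z z.
  rewrite zz; have : 0 <= r ^+ 2 * (k - a ^+ 2) by rewrite mulr_ge0 ?sqr_ge0//; lra.
  by nra.
have z0 : z != 0 by rewrite -dotv_eq0 gt_eqF//; lra.
split=> //; have /andP[_ c1] := dotv_bound x (direction z).
have := dotv_direction (\val x) z0.
set c := dotv (\val x) (\val (direction z)) in c1 * => cE.
have zs : 0 < Num.sqrt (dotv z z) by rewrite sqrtr_gt0; lra.
have c0 : 0 < c by rewrite cE mulr_gt0 ?invr_gt0// zx; lra.
have : c ^+ 2 * dotv z z = (1 + r * a) ^+ 2.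
  rewrite -{1}[dotv z z](sqr_sqrtr (dotv_ge0 _)) -exprMn cE mulrAC.
  by rewrite mulVf ?mul1r ?zx// gt_eqF.
move=> czz; rewrite ltNge; apply/negP => ce.
have rr : r ^+ 2 * (b + 1) <= e / 8.
  have : 0 <= (1 / 2 - r) * e by apply: mulr_ge0; nra.
  have : 0 <= r * (e - r * (4 * (b + 1))) by apply: mulr_ge0; lra.
  by lra.
have : r ^+ 2 * (k - a ^+ 2) <= r ^+ 2 * (b + 1).
  by rewrite ler_wpM2l ?sqr_ge0//; have := sqr_ge0 a; lra.
have -> : r ^+ 2 * (k - a ^+ 2) = (1 - c ^+ 2) * dotv z z.
  by rewrite mulrBl mul1r czz zz; ring.
have : e * (9 / 16) <= (1 - c ^+ 2) * dotv z z.
  by apply: ler_pM; [lra|lra|nra|exact: zz1].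
by lra.
Qed.

Lemma nbhs_direction x w A : nbhs x A -> exists2 s : R, 0 < s &
  \val x + s *: w != 0 /\ A (direction (\val x + s *: w)).
Proof.
move=> /nbhs_sphereP[e e0 eA].
have [s /andP[s0 _] sP] := dotv_direction_near e0 (dotv_ge0 w).
exists s => //; have [|xw ?] := sP s x w _ (lexx _); first by rewrite s0/=.
by split=> //; exact: eA.
Qed.

Lemma closed_cone_trace us : closed (cone_trace us).
Proof.
rewrite (_ : cone_trace us = \bigcap_(u in [set` us]) half_sphere u)//.
apply: closed_bigI => u _.
apply: (@closed_comp _ _ (fun x => dotv u (\val x)) [set r | 0 <= r]).
  by move=> x _; exact: continuous_dotv_val.
exact: closed_ge.
Qed.

(** As no u is zero, a small step in the direction -u from a point with [dotv u x = 0] leaves the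
    half-sphere. The description holds for every family [us], also a redundant one. *)
Lemma interior_cone_trace us x : 0 \notin us ->
  (cone_trace us)° x <-> forall u, u \in us -> 0 < dotv u (\val x).
Proof.
move=> us0; split=> [xi u uus|].
  have [s s0 [xu]] := nbhs_direction (- u) xi.
  move=> /(_ u uus); rewrite /half_sphere/= dotv_direction_ge0// !dotvE.
  apply: contraPlt => ux; apply/negP; rewrite -ltNge.
  have : 0 < dotv u u by apply: dotv_gt0; apply: contraNneq us0 => <-.
  by nra.
elim: us us0 => [|u us ih]; first by move=> _ _; apply: filterS filterT.
rewrite inE negb_or => /andP[_ us0] h.
have hu : 0 < dotv u (\val x) by apply: h; rewrite mem_head.
have {}ih : nbhs x (cone_trace us).
  by apply: ih => // v vus; apply: h; rewrite inE vus orbT.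
have hn : nbhs x [set y | 0 < dotv u (\val y)].
  exact: (cvgr_gt _ (@continuous_dotv_val _ _ u x) _ hu).
apply: filterS (filterI ih hn) => y [ys uy] v.
by rewrite inE => /predU1P[->|/ys//]; exact: ltW.
Qed.

Lemma polytopeP p : (p : set _) !=set0 /\
  exists2 us, 0 \notin us & (p : set _) = cone_trace us.
Proof. by case: p => C /= /asboolP[C0 [us [us0 CE]]]; split=> //; exists us. Qed.

Lemma polytope_inj p q : (p : set _) = q -> p = q.
Proof. exact: val_inj. Qed.

Lemma closed_polytope p : closed p.
Proof. by have [_ [us _ ->]] := polytopeP p; exact: closed_cone_trace. Qed.

(** Full dimension means that no u of the family vanishes on the whole trace; w is a sum of points
    of the trace, one with a positive product for each u in us'. The induction is on us' alone,
    since nonnegativity is kept for all of us. *)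
Lemma full_dim_strict us us' : has_dim (cone_trace us) d ->
  0 \notin us -> {subset us' <= us} ->
  exists2 w, forall u, u \in us -> 0 <= dotv u w &
             forall u, u \in us' -> 0 < dotv u w.
Proof.
move=> [_ dimL] us0; elim: us' => [_|u us' ih uss].
  by exists 0 => // u _; rewrite dotvC dot0v.
have [|w w0 w1] := ih; first by move=> v vus; apply: uss; rewrite inE vus orbT.
have uus : u \in us by apply: uss; rewrite mem_head.
have [x xus ux] : exists2 x, cone_trace us x & dotv u (\val x) != 0.
  apply: contrapT => nx.
  have u0 : u != 0 by apply: contraNneq us0 => <-.
  have [L dL LE] := orthogonal_subspace u0.
  suff /dimL : in_subspace (cone_trace us) L by rewrite dL ltnn.
  move=> x xus; rewrite LE; apply/negPn/negP => ux; apply: nx.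
  by exists x.
exists (w + \val x) => v vus; rewrite dotvDr.
  by rewrite addr_ge0 ?w0//; exact: xus.
move: vus; rewrite inE => /predU1P[->|vus].
  rewrite ltr_wpDl ?w0// lt_def ux; exact: xus.
by rewrite ltr_pwDl ?w1//; apply: xus; apply: uss; rewrite inE vus orbT.
Qed.

(** A vector w that is strictly positive on all constraints points inwards from every x in p, so a
    small push along w enters the interior. *)
Lemma interior_dense p x A : has_dim p d -> polytope_set p x -> nbhs x A ->
  exists2 y, A y & p° y.
Proof.
have [_ [us us0 pE]] := polytopeP p; rewrite pE => pd px xA.
have [//|w _ wP] := full_dim_strict (us' := us) pd us0.
have [s s0 [xw Ax]] := nbhs_direction w xA.
exists (direction (\val x + s *: w)) => //.
apply/interior_cone_trace => // u uus; rewrite dotv_direction_gt0// dotvDr dotvZr.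
by rewrite ltr_wpDl ?mulr_gt0 ?wP//; exact: px.
Qed.

(** A subspace containing C contains x and, up to scaling, x + s v for each v and some s > 0; hence
    it contains v. *)
Lemma interior_has_dim C x : C° x -> has_dim C d.
Proof.
have dimf : \dim {: 'rV[R]_d.+1} = d.+1 by rewrite dimvf /dim /= mul1n.
move=> xC; split; first by exists fullv => // y _; exact: memvf.
move=> L CL; apply: (@leq_trans (\dim {: 'rV[R]_d.+1})); first by rewrite dimf.
apply: dimvS; apply/subvP => v _.
have [s s0 [xv /CL]] := nbhs_direction v xC.
rewrite val_direction//.
move=> /(memvZ (Num.sqrt (dotv (\val x + s *: v) (\val x + s *: v)))).
rewrite scalerA divff ?scale1r; last by rewrite gt_eqF// sqrtr_gt0 dotv_gt0.
have /CL xL := interior_subset xC.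
move=> xvL; have := memvB xvL xL; rewrite addrAC subrr add0r.
by move=> /(memvZ s^-1); rewrite scalerA mulVf ?scale1r// gt_eqF.
Qed.

End Polytopes.

(** * Borel sets of hyperspheres, polytopes and tessellations *)

Section Measurability.
Variables (R : realType) (d : nat).
Implicit Types (u v w : 'rV[R]_d.+1) (x y z : sphere R d).
Implicit Types (A B C U : set (sphere R d)) (p q c : polytope R d).
Implicit Types (S : hypersphere R d) (T : tessellation R d).

Lemma measurable_hits_open U : (0 < d)%N -> open U -> measurable (hits (d := d) U).
Proof.
move=> d0 oU; apply: sub_sigma_algebra => S [x [Sx Ux]].
have : nbhs x U by exact: open_nbhs_nbhs.
move=> /nbhs_sphereP[e e0 eU]; have [r r0 rP] := geod_small d e0.
exists r => // S' /hausdorff_dist_lt[||/(_ x Sx)[y S'y xy] _].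
- exact: hypersphere_neq0.
- exact: hypersphere_neq0.
by exists y; split=> //; apply: eU; exact: rP.
Qed.

Lemma measurable_hits_int B : (0 < d)%N -> measurable (hits_int (d := d) B).
Proof. by move=> d0; apply: measurable_hits_open => //; exact: open_interior. Qed.

(** By compactness the linear form of a hypersphere missing C is bounded away from 0 on C, so nearby
    hyperspheres miss C as well: the complement is open. *)
Lemma measurable_hits_closed C :
  (0 < d)%N -> closed C -> measurable (hits (d := d) C).
Proof.
move=> d0 cC; rewrite -(setCK (hits C)); apply: measurableC.
apply: sub_sigma_algebra => S SC; have [u u0 SE] := hypersphereP S.
pose f x := dotv u (\val x); have cf : continuous f by exact: continuous_dotv_val.
have [||m m0 mP] := @closed_lower_bound _ _ C (fun x => f x * f x) cC.
- by move=> x; apply: continuousM; exact: cf.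
- move=> x Cx; rewrite -expr2 lt_def sqr_ge0 andbT sqrf_eq0; apply/eqP => ux.
  by apply: SC; exists x; split=> //; rewrite SE.
have uu := dotv_gt0 u0.
(* With this cap, [dotv_lipschitz] makes the squared values of the form on S' smaller than 2 |u|^2 m
   / (2 |u|^2) = m, their minimum on C. *)
have [r r0 rP] := geod_small d (divr_gt0 m0 (mulr_gt0 (ltr0Sn R 1) uu)).
exists r => // S' /hausdorff_dist_lt[||_ h [y [S'y Cy]]].
- exact: hypersphere_neq0.
- exact: hypersphere_neq0.
have [x Sx xy] := h y S'y.
have := mP y Cy; apply/negP; rewrite -ltNge -expr2.
have := dotv_lipschitz u x y; move: Sx; rewrite SE/= => ->.
rewrite sub0r sqrrN => /le_lt_trans; apply.
have := rP _ _ xy; rewrite -(ltr_pM2l uu) mulrBr mulr1.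
have -> : dotv u u * (m / (2 * dotv u u)) = m / 2.
  by field; rewrite gt_eqF.
by lra.
Qed.

(** Compactness of C and finiteness of the family of half-spheres give one margin for all points of
    C. *)
Lemma interior_thick C p : closed C -> C `<=` (p : set _)° ->
  exists2 e : R, 0 < e & forall x y, C x ->
    1 - e < dotv (\val x) (\val y) -> polytope_set p y.
Proof.
move=> cC; have [_ [us us0 ->]] := polytopeP p => Cp.
have {Cp} : forall u, u \in us -> u != 0 /\ forall x, C x -> 0 < dotv u (\val x).
  move=> u uus; split; first by apply: contraNneq us0 => <-.
  by move=> x Cx; apply: (interior_cone_trace _ us0).1 uus; exact: Cp.
elim: us {us0} => [_|u us ih h]; first by exists 1.
have [|e e0 eP] := ih; first by move=> v vus; apply: h; rewrite inE vus orbT.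
have [u0 Cu] := h u (mem_head _ _); have uu := dotv_gt0 u0.
have [m m0 mP] := closed_lower_bound cC (@continuous_dotv_val _ _ u) Cu.
exists (Num.min e (m ^+ 2 / (2 * dotv u u))).
  by rewrite lt_min e0/= divr_gt0// ?mulr_gt0// exprn_gt0.
move=> x y Cx xy v; rewrite inE => /predU1P[->|vus]; last first.
  by apply: (eP x) => //; apply: le_lt_trans xy; rewrite lerB// ge_min lexx.
have {}xy : 1 - m ^+ 2 / (2 * dotv u u) < dotv (\val x) (\val y).
  by apply: le_lt_trans xy; rewrite lerB// ge_min lexx orbT.
rewrite /half_sphere/= leNgt; apply/negP => uy.
have := dotv_lipschitz u x y; apply/negP; rewrite -ltNge.
apply: (@lt_le_trans _ _ (m ^+ 2)); last by have := mP x Cx; nra.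
move: xy; rewrite -(ltr_pM2l uu (1 - _)) mulrBr mulr1.
have -> : dotv u u * (m ^+ 2 / (2 * dotv u u)) = m ^+ 2 / 2.
  by field; rewrite gt_eqF.
by lra.
Qed.

(** The condition is open in p. If q is close to p and a constraint of q with unit normal n is not
    strict at x in C, a step of length s from x along -n stays in p by thickness, but ends at inner
    product at most -s/2 with n, too far from every point of q. *)
Lemma measurable_interior_superset C : closed C ->
  measurable [set p : polytope R d | C `<=` (p : set _)°].
Proof.
move=> cC; apply: sub_sigma_algebra => p /= Cp.
have [e e0 eP] := interior_thick cC Cp.
have [s /andP[s0 s1] sP] := dotv_direction_near d e0 ler01.
(* By [dotv_lipschitz], a cap of height s^2/8 changes the product with the unit vector n by less
   than s/2. *)
have [|r r0 rP] := @geod_small R d (s ^+ 2 / 8); first by rewrite divr_gt0// exprn_gt0.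
have [p0 _] := polytopeP p.
exists r => // q; have [q0 [us us0 qE]] := polytopeP q.
move=> /hausdorff_dist_lt[//|//|pq _] x Cx.
rewrite qE; apply/interior_cone_trace => // u uus; rewrite ltNge; apply/negP => ux.
have u0 : u != 0 by apply: contraNneq us0 => <-.
pose n := direction u.
have [||z0 xz] := sP s x (- \val n) _ _; first by rewrite s0/=.
  by rewrite dotvNl dotvNr dotv_val opprK.
have [y qy zy] := pq _ (eP _ _ Cx xz).
have ny : 0 <= dotv (\val n) (\val y).
  by rewrite dotvC dotv_direction_ge0// dotvC; move: qy; rewrite qE; exact.
have := dotv_lipschitz (\val n) (direction (\val x + s *: - \val n)) y.
apply/negP; rewrite -ltNge dotv_val mul1r.
apply: (@lt_le_trans _ _ (s ^+ 2 / 4)); first by have := rP _ _ zy; lra.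
suff : dotv (\val n) (\val (direction (\val x + s *: - \val n))) <= - (s / 2).
  by nra.
rewrite dotv_direction//; set zz := dotv _ _; rewrite !dotvE dotv_val.
have nx : dotv (\val n) (\val x) <= 0.
  by rewrite dotvC leNgt dotv_direction_gt0// -leNgt dotvC.
have zz0 : 0 < Num.sqrt zz by rewrite sqrtr_gt0 dotv_gt0.
rewrite mulrC ler_pdivrMr//.
have zz2 : Num.sqrt zz <= 2.
  rewrite -[leRHS](@ger0_norm _ 2)// -sqrtr_sqr ler_wsqrtr//.
  rewrite /zz !dotvE !dotv_val (dotvC (\val x)).
  by have /andP[] := dotv_bound n x; nra.
by nra.
Qed.

(** Distinct closed sets have positive Hausdorff distance: a point of one that is missing from the
    other has a cap around it disjoint from the latter. *)
Lemma measurable_polytope1 c : measurable [set c].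
Proof.
rewrite -(setCK [set c]); apply: measurableC; apply: sub_sigma_algebra => p /= pc.
have sep A B x : closed B -> A x -> ~ B x -> exists2 r : R, 0 < r &
    forall y, B y -> geod x y < r -> False.
  move=> cB Ax Bx; have : nbhs x (~` B).
    by apply: open_nbhs_nbhs; split=> //; exact: closed_openC.
  move=> /nbhs_sphereP[e e0 eB]; have [r r0 rP] := geod_small d e0.
  by exists r => // y By /rP/eB.
have [p0 _] := polytopeP p; have [c0 _] := polytopeP c.
have [/existsNP[x /not_implyP[px cx]]|pSc] := pselect (~ ((p : set _) `<=` c)).
  have [r r0 rP] := sep _ _ x (@closed_polytope _ _ c) px cx.
  exists r => // q /hausdorff_dist_lt + qc; rewrite qc => -[//|//|/(_ x px)[y cy xy] _].
  exact: rP xy.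
have [/existsNP[x /not_implyP[cx px]]|cSp] := pselect (~ ((c : set _) `<=` p)).
  have [r r0 rP] := sep _ _ x (@closed_polytope _ _ p) cx px.
  exists r => // q /hausdorff_dist_lt + qc; rewrite qc => -[//|//|_ /(_ x cx)[y py yx]].
  by apply: (rP y py); rewrite geodC.
by exfalso; apply: pc; apply: polytope_inj; apply/seteqP; split; exact: contrapT.
Qed.

Lemma measurable_has_cell (B : set (polytope R d)) : measurable B ->
  measurable [set T : tessellation R d | exists2 c, cells T c & B c].
Proof.
move=> mB; rewrite -(setCK [set T | _]); apply: measurableC.
apply: sub_sigma_algebra; exists B, 0%N; split=> //.
apply/seteqP; split=> T /=.
  move=> nT; rewrite II0 card_eq0; apply/eqP/seteqP; split=> // c [Tc Bc].
  by apply: nT; exists c.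
by rewrite II0 card_eq0 => /eqP TB [c Tc Bc]; have : set0 c by rewrite -TB.
Qed.

Lemma tessellationP T : is_tessellation T.
Proof. by case: T => T /= /asboolP. Qed.

(** Equality with T says that every cell of T is present and that no other cell is; T being finite,
    both are measurable. This makes the indicator of {T} an admissible argument of the generator. *)
Lemma measurable_tessellation1 T : measurable [set T].
Proof.
have [finT _ _ _] := tessellationP T.
have -> : [set T] = \bigcap_(c in cells T) [set T' | exists2 c', cells T' c' & [set c] c']
    `&` ~` [set T' | exists2 c', cells T' c' & (~` cells T) c'].
  apply/seteqP; split=> [_ ->|T' [h1 h2]].
    by split=> [c Tc|[c]//]; exists c.
  apply: val_inj; apply/seteqP; split=> c cT.
    by apply: contrapT => ncT; apply: h2; exists c.
  by have [c' Tc' cc'] := h1 c cT; rewrite -cc'.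
apply: measurableI; last apply: measurableC.
  apply: fin_bigcap_measurable => // c _; apply: measurable_has_cell.
  exact: measurable_polytope1.
apply: measurable_has_cell; apply: measurableC.
rewrite (_ : cells T = \bigcup_(c in cells T) [set c]).
  by apply: fin_bigcup_measurable => // c _; exact: measurable_polytope1.
by rewrite bigcup_imset1 image_id.
Qed.

End Measurability.

(** * Splitting a cell *)

Section Splitting.
Variables (R : realType) (d : nat).
Implicit Types (u v w : 'rV[R]_d.+1) (x y z : sphere R d).
Implicit Types (A B C : set (sphere R d)) (p q c : polytope R d).
Implicit Types (S : hypersphere R d) (T : tessellation R d).

Lemma interior_half_sphere u x : u != 0 ->
  (half_sphere u)° x <-> 0 < dotv u (\val x).
Proof.
move=> u0; have -> : half_sphere u = cone_trace [:: u].
  apply/seteqP; split=> [y uy v|y]; first by rewrite inE => /eqP ->.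
  by apply; rewrite mem_head.
rewrite interior_cone_trace ?inE 1?eq_sym//.
by split=> [|h v]; [apply; rewrite mem_head|rewrite inE => /eqP ->].
Qed.

Lemma interior_cap_half A u x : u != 0 ->
  (A `&` half_sphere u)° x <-> A° x /\ 0 < dotv u (\val x).
Proof.
move=> u0; rewrite interiorI; split=> -[Ax /=].
  by move=> /(interior_half_sphere _ u0).
by move=> ux; split=> //; exact/interior_half_sphere.
Qed.

Lemma is_polytope_cap_half c u : u != 0 ->
  (c : set _) `&` half_sphere u !=set0 ->
  is_polytope ((c : set _) `&` half_sphere u).
Proof.
move=> u0 cu0; split=> //; have [_ [us us0 ->]] := polytopeP c.
exists (u :: us); split; first by rewrite inE negb_or eq_sym u0.
apply/seteqP; split=> [x [xus ux] v|x xus]; first by rewrite inE => /predU1P[->//|/xus].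
split; last by apply: xus; rewrite mem_head.
by move=> v vus; apply: xus; rewrite inE vus orbT.
Qed.

(** A small step from x along u ends in the interior of the half, so a cut through the interior of a
    cell leaves full-dimensional pieces. *)
Lemma dotv_cut c u x : u != 0 -> (c : set _)° x -> dotv u (\val x) = 0 ->
  exists2 p : polytope R d,
    (p : set _) = (c : set _) `&` half_sphere u & (p : set _)° !=set0.
Proof.
move=> u0 cx ux; have cn := open_nbhs_nbhs (conj (open_interior _) cx).
have [s s0 [xu cy]] := nbhs_direction u cn.
set y := direction _ in cy.
have yi : ((c : set _) `&` half_sphere u)° y.
  apply/interior_cap_half => //; split=> //.
  by rewrite dotv_direction_gt0// !dotvE ux add0r mulr_gt0// dotv_gt0.
have pc : is_polytope ((c : set _) `&` half_sphere u).
  by apply: is_polytope_cap_half => //; exists y; exact: interior_subset yi.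
by exists (Polytope (asboolT pc)) => //; exists y.
Qed.

Lemma half_sphereN_sides S u H : u != 0 ->
  (S : set (sphere R d)) = [set x | dotv u (\val x) = 0] ->
  sides S H <-> H = half_sphere u \/ H = half_sphere (- u).
Proof.
move=> u0 SE; split=> [[v [v0 SE' ->]]|[] ->]; last 2 first.
- by exists u.
- exists (- u); rewrite oppr_eq0; split=> //; rewrite SE.
  apply/seteqP; split=> x /=; rewrite dotvNl; first by move=> ->; rewrite oppr0.
  by move=> /eqP; rewrite oppr_eq0 => /eqP.
(* Two normals of one hypersphere are proportional: the part of w orthogonal to u lies, after
   scaling, in S, so v annihilates it. The sign of a decides which half-sphere v defines. *)
have uu := dotv_gt0 u0; pose a := dotv v u / dotv u u.
have vE w : dotv v w = a * dotv u w.
  pose z := w - (dotv u w / dotv u u) *: u.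
  have uz : dotv u z = 0.
    by rewrite /z !dotvE; field; rewrite gt_eqF.
  suff : dotv v z = 0.
    rewrite /z !dotvE /a => /eqP; rewrite subr_eq0 => /eqP ->.
    by field; rewrite gt_eqF.
  have [->|z0] := eqVneq z 0; first by rewrite dotvC dot0v.
  apply/eqP; rewrite -(dotv_direction_eq0 _ z0); apply/eqP.
  have : (S : set (sphere R d)) (direction z).
    by rewrite SE /=; apply/eqP; rewrite dotv_direction_eq0// uz.
  by rewrite SE'.
have a0 : a != 0.
  by apply: contraNneq v0 => a0; rewrite -dotv_eq0 vE a0 mul0r.
have [ap|an] := ltP 0 a; [left|right].
  by apply/seteqP; split=> x; rewrite /half_sphere/= vE pmulr_rge0.
have {}an : a < 0 by rewrite lt_neqAle a0.
by apply/seteqP; split=> x;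
  rewrite /half_sphere/= vE dotvNl nmulr_rge0// oppr_ge0.
Qed.

Lemma card_fset_set_setU2 (I : choiceType) (A B : set I) (a b : I) :
  finite_set A -> B `<=` A `|` [set a; b] ->
  (#|` fset_set B| <= #|` fset_set A| + 2)%N.
Proof.
move=> fA BA; have fAa : finite_set (A `|` [set a]).
  by rewrite finite_setU; split=> //; exact: finite_set1.
have fU : finite_set (A `|` [set a; b]).
  by rewrite setUA finite_setU; split=> //; exact: finite_set1.
apply: (@leq_trans #|` fset_set (A `|` [set a; b])|).
  by apply/fsubset_leq_card; rewrite -fset_set_sub//; exact: sub_finite_set BA fU.
rewrite setUA !fset_setU ?fset_set1//; do 2!rewrite cardfsU cardfs1.
by apply: (leq_trans (leq_subr _ _)); rewrite (addnA _ 1%N 1%N) leq_add2r leq_subr.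
Qed.

Lemma finite_split_cells c S (T : set (polytope R d)) : exists p q,
  split_cells c S T `<=` T `|` [set p; q].
Proof.
have [u u0 SE] := hypersphereP S.
(* When no polytope has A as its set, [pol A] is the default c; this is harmless, as only an
   inclusion is claimed. *)
pose pol A := xget c [set p | (p : set _) = A].
exists (pol (c `&` half_sphere u)), (pol (c `&` half_sphere (- u))).
have polE A p : (p : set _) = A -> p = pol A.
  move=> pA; apply: polytope_inj.
  by rewrite pA; apply/esym/(@xgetPex _ c [set p | (p : set _) = A]); exists p.
move=> p [[Tp _]|[H /(half_sphereN_sides _ u0 SE)[] -> pE]]; [by left| |]; right.
  by left; exact: polE.
by right; exact: polE.
Qed.

Lemma is_tessellation_split c S T : cells T c -> hits_int c S ->
  is_tessellation (split_cells c S T).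
Proof.
move=> Tc [x0 [Sx0 cx0]]; have [finT dimT disT covT] := tessellationP T.
have [u u0 SE] := hypersphereP S.
have ux0 : dotv u (\val x0) = 0 by move: Sx0; rewrite SE.
have nu0 : - u != 0 by rewrite oppr_eq0.
have [p pE p0] := dotv_cut u0 cx0 ux0.
have [q qE q0] : exists2 p : polytope R d, (p : set _) = (c : set _) `&` half_sphere (- u)
    & (p : set _)° !=set0.
  by apply: (dotv_cut nu0 cx0); rewrite dotvNl ux0 oppr0.
have -> : split_cells c S T = (cells T `\ c) `|` [set p; q].
  apply/seteqP; split=> r [Tr|rS]; [by left|right|by left|right].
    case: rS => H /(half_sphereN_sides _ u0 SE)[] -> rE.
      by left; have -> : r = p by [apply: polytope_inj; rewrite pE].
    by right; have -> : r = q by [apply: polytope_inj; rewrite qE].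
  case: rS => ->.
    by exists (half_sphere u) => //; apply/(half_sphereN_sides _ u0 SE); left.
  by exists (half_sphere (- u)) => //; apply/(half_sphereN_sides _ u0 SE); right.
have pc : (p : set _)° `<=` (c : set _)°.
  by rewrite pE => x /(interior_cap_half _ _ u0)[].
have qc : (q : set _)° `<=` (c : set _)°.
  by rewrite qE => x /(interior_cap_half _ _ nu0)[].
have pq : (p : set _)° `&` (q : set _)° = set0.
  rewrite pE qE; apply/seteqP; split=> // x [].
  move=> /(interior_cap_half _ _ u0)[_ h1] /(interior_cap_half _ _ nu0)[_].
  by rewrite dotvNl oppr_gt0 => /(lt_trans h1); rewrite ltxx.
have disc (r r' : polytope R d) : (cells T `\ c) r -> (r' : set _)° `<=` (c : set _)° ->
    (r : set _)° `&` (r' : set _)° = set0.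
  move=> [Tr rc] r'c; apply/seteqP; split=> // x [rx /r'c cx].
  by rewrite -(disT _ _ Tr Tc rc); split.
split.
- rewrite finite_setU; split; first exact: finite_setD.
  by rewrite finite_setU; split; exact: finite_set1.
- move=> r [[Tr _]|[|] ->]; first exact: dimT.
    by case: p0 => x px; exact: interior_has_dim px.
  by case: q0 => x qx; exact: interior_has_dim qx.
- move=> r r' [Tr|[|] ->] [Tr'|[|] ->] rr' //.
  + by case: Tr Tr' => Tr _ [Tr' _]; exact: disT.
  + exact: disc.
  + exact: disc.
  + by rewrite setIC; exact: disc.
  + by rewrite setIC; exact: disc.
  + by rewrite setIC.
- apply/seteqP; split=> // x _; have : setT x by [].
  rewrite -covT => -[r Tr rx]; have [rc|rc] := pselect (r = c); last first.
    by exists r => //; left.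
  rewrite rc in rx; have [ux|ux] := leP 0 (dotv u (\val x)).
    by exists p; [right; left|rewrite pE].
  exists q; first by right; right.
  by rewrite qE; split=> //; rewrite /half_sphere/= dotvNl oppr_ge0 ltW.
Qed.

Lemma split_cellP c S T : cells (split_cell c S T) = cells T \/
  cells (split_cell c S T) = split_cells c S T.
Proof.
rewrite /split_cell; have := val_insubd T (split_cells c S (cells T)).
by case: ifP => _ /= ->; [right|left].
Qed.

Lemma cells_split_cell c S T : cells T c -> hits_int c S ->
  cells (split_cell c S T) = split_cells c S T.
Proof.
by move=> Tc cS; rewrite /split_cell insubdK//; apply/asboolP/is_tessellation_split.
Qed.

Definition ncells T := #|` fset_set (cells T)|.

Lemma ncells_split c S T : (ncells (split_cell c S T) <= ncells T + 2)%N.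
Proof.
have [finT _ _ _] := tessellationP T.
rewrite /ncells; have [->|->] := split_cellP c S T; first by rewrite leq_addr.
have [p [q pq]] := finite_split_cells c S T.
exact: card_fset_set_setU2 pq.
Qed.

End Splitting.

(** * Tessellations with a cell containing C in its interior *)

Section Inside.
Variables (R : realType) (d : nat).
Implicit Types (u v w : 'rV[R]_d.+1) (x y z : sphere R d).
Implicit Types (A B C : set (sphere R d)) (p q c : polytope R d).
Implicit Types (S : hypersphere R d) (T : tessellation R d).

Definition inside C : set (tessellation R d) :=
  [set T | exists2 c : polytope R d, cells T c & C `<=` (c : set _)°].

Lemma measurable_inside C : closed C -> measurable (inside C).
Proof. by move=> cC; apply: measurable_has_cell; exact: measurable_interior_superset. Qed.

Lemma inside_unique C T c c' : C !=set0 -> cells T c -> cells T c' ->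
  C `<=` (c : set _)° -> C `<=` (c' : set _)° -> c = c'.
Proof.
move=> [x Cx] Tc Tc' Cc Cc'; have [_ _ disT _] := tessellationP T.
apply: contrapT => cc'; change (@set0 (sphere R d) x).
by rewrite -(disT _ _ Tc Tc' cc'); split; [exact: Cc|exact: Cc'].
Qed.

Lemma connected_sign C (f : sphere R d -> R) : connected C -> C !=set0 ->
  continuous f -> (forall x, C x -> f x != 0) ->
  (forall x, C x -> 0 < f x) \/ (forall x, C x -> f x < 0).
Proof.
move=> cC [x0 Cx0] cf f0.
have pos (g : sphere R d -> R) : continuous g -> (forall x, C x -> g x != 0) ->
    0 < g x0 -> forall x, C x -> 0 < g x.
  move=> cg g0 gx0.
  have eC : C `&` [set x | 0 < g x] = C.
    apply: cC; first by exists x0; split.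
      exists [set x | 0 < g x] => //.
      by apply: (open_comp (f := g) (D := [set r | 0 < r])) => // x _; exact: cg.
    exists [set x | 0 <= g x].
      by apply: (closed_comp (f := g) (D := [set r | 0 <= r])) => // x _; exact: cg.
    apply/seteqP; split=> x [Cx /= gx]; split=> //=; first exact: ltW.
    by rewrite lt_def g0.
  by move=> x; rewrite -{1}eC => -[].
have [fx0|fx0|fx0] := ltgtP 0 (f x0); last by have := f0 _ Cx0; rewrite -fx0 eqxx.
  by left; exact: pos.
right=> x Cx; rewrite -oppr_gt0; apply: (pos (fun x => - f x)) => //.
- by move=> y; apply: continuousN; exact: cf.
- by move=> y Cy; rewrite oppr_eq0 f0.
- by rewrite oppr_gt0.
Qed.

Lemma split_cells_sub c S (T : set (polytope R d)) p : T c ->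
  split_cells c S T p -> exists2 q, T q & (p : set _) `<=` q.
Proof.
move=> Tc [[Tp _]|[H _ ->]]; first by exists p.
by exists c => // x [].
Qed.

Lemma inside_split_sub C c S T : cells T c ->
  inside C (split_cell c S T) -> inside C T.
Proof.
move=> Tc [p]; have [->|->] := split_cellP c S T; first by move=> Tp Cp; exists p.
move=> /(split_cells_sub Tc)[q Tq pq] Cp; exists q => // x /Cp.
exact: interiorS.
Qed.

Lemma inside_split_other C c c' S T : cells T c' -> c' <> c ->
  C `<=` (c' : set _)° -> inside C (split_cell c S T).
Proof.
move=> Tc' cc' Cc'; exists c' => //.
by have [->//|->] := split_cellP c S T; left.
Qed.

(** If S misses C, its linear form has constant sign on the connected set C, which then lies inside
    one half. If S meets C, neither half has the common point in its interior, and the other cells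
    have interiors disjoint from that of c. *)
Lemma inside_split_cut C c S T : connected C -> C !=set0 -> cells T c ->
  C `<=` (c : set _)° -> hits_int c S ->
  inside C (split_cell c S T) <-> ~ hits C S.
Proof.
move=> cC C0 Tc Cc cS; have [u u0 SE] := hypersphereP S; split.
  move=> [p]; rewrite cells_split_cell//.
  move=> [[Tp pc] Cp|[H /(half_sphereN_sides _ u0 SE) HE pE] Cp] [x [Sx Cx]].
    by apply: pc; apply: inside_unique C0 Tp Tc Cp Cc.
  move: (Cp x Cx); rewrite pE SE/= in Sx *.
  case: HE => -> /interior_cap_half.
    by move=> /(_ u0)[_]; rewrite Sx ltxx.
  by rewrite oppr_eq0 => /(_ u0)[_]; rewrite dotvNl Sx oppr0 ltxx.
move=> nCS.
have aux v : v != 0 -> sides S (half_sphere v) ->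
    (forall x, C x -> 0 < dotv v (\val x)) -> inside C (split_cell c S T).
  move=> v0 Sv Cv.
  have Ci : C `<=` ((c : set _) `&` half_sphere v)°.
    by move=> x Cx; apply/interior_cap_half => //; split; [exact: Cc|exact: Cv].
  have pp : is_polytope ((c : set _) `&` half_sphere v).
    apply: is_polytope_cap_half => //; have [x Cx] := C0.
    by exists x; exact: interior_subset (Ci x Cx).
  exists (Polytope (asboolT pp)) => //; rewrite cells_split_cell//; right.
  by exists (half_sphere v).
have [||Cu|Cu] := @connected_sign C (fun x => dotv u (\val x)) cC C0.
- exact: continuous_dotv_val.
- by move=> x Cx; apply/eqP => ux; apply: nCS; exists x; split=> //; rewrite SE.
- by apply: (aux u) => //; apply/(half_sphereN_sides _ u0 SE); left.
- apply: (aux (- u)); rewrite ?oppr_eq0//.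
    by apply/(half_sphereN_sides _ u0 SE); right.
  by move=> x Cx; rewrite dotvNl oppr_gt0; exact: Cu.
Qed.

(** The eigenfunction property before integration over S and summation over c: only the cell around
    C contributes, and only when S hits C. *)
Lemma inside_split_indic C c S T : connected C -> C !=set0 -> cells T c ->
  hits_int c S ->
  \1_(inside C) (split_cell c S T) - \1_(inside C) T =
  - (\1_[set q : polytope R d | C `<=` (q : set _)°] c * \1_(hits C) S) :> R.
Proof.
move=> cC C0 Tc cS; rewrite !indicE.
have [[c0 Tc0 Cc0]|nT] := pselect (inside C T); last first.
  rewrite [T \in _]memNset// [split_cell _ _ _ \in _]memNset; last first.
    by move/(inside_split_sub Tc).
  rewrite [c \in _]memNset ?mul0r ?subrr ?oppr0// => Cc.
  by apply: nT; exists c.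
rewrite [T \in _]mem_set; last by exists c0.
have [cc0|cc0] := pselect (c0 = c); last first.
  rewrite (mem_set (inside_split_other S Tc0 cc0 Cc0)).
  rewrite [c \in _]memNset ?mul0r ?subrr ?oppr0// => Cc.
  by apply: cc0; exact: inside_unique Tc0 Tc Cc0 Cc.
rewrite cc0 in Cc0; rewrite [c \in _]mem_set// mul1r.
have h := inside_split_cut cC C0 Tc Cc0 cS.
have [CS|CS] := pselect (hits C S).
  by rewrite [split_cell _ _ _ \in _]memNset ?sub0r ?[S \in _]mem_set// => /h.
by rewrite [split_cell _ _ _ \in _]mem_set ?subrr ?[S \in _]memNset ?oppr0//; exact/h.
Qed.

(** If the skeleton misses C, the trace on C of any cell is both open and closed in C. Conversely, a
    boundary point of a cell p inside the interior of another cell would bring interior points of p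
    there, by [interior_dense]. *)
Lemma inside_skeleton C T : closed C -> connected C -> C !=set0 ->
  skeleton T `&` C = set0 <-> inside C T.
Proof.
move=> clC cC [x0 Cx0]; have [finT dimT disT covT] := tessellationP T.
split=> [TC|[c Tc Cc]].
  have inn c x : cells T c -> C x -> polytope_set c x -> (c : set _)° x.
    move=> Tc Cx cx; apply: contrapT => ncx; change (@set0 (sphere R d) x).
    rewrite -TC; split=> //; exists c => //; split=> //; exact: subset_closure.
  have : setT x0 by []; rewrite -covT => -[c Tc cx0].
  exists c => //; suff <- : C `&` (c : set _)° = C by move=> x [].
  apply: cC; first by exists x0; split=> //; exact: inn.
    by exists (c : set _)° => //; exact: open_interior.
  exists (c : set _); first exact: closed_polytope.
  apply/seteqP; split=> x [Cx cx]; split=> //; last exact: inn.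
  exact: interior_subset cx.
apply/seteqP; split=> // x [[p Tp [px npx]] Cx].
have {}px : polytope_set p x by exact: closed_polytope.
have [cp|cp] := pselect (c = p); first by apply: npx; rewrite -cp; exact: Cc.
have cn := open_nbhs_nbhs (conj (open_interior _) (Cc x Cx)).
have [y cy py] := interior_dense (dimT _ Tp) px cn.
change (@set0 (sphere R d) y).
by rewrite -(disT _ _ Tc Tp cp); split; [exact: cy|exact: py].
Qed.

End Inside.

(** * The backward equation *)

Section RealAnalysis.
Variable R : realType.
Implicit Types (phi : R -> R) (s t h : R).

(** Only where phi is positive is the sign of the derivative prescribed. The barrier e (1 + t) has
    positive slope, and left continuity prevents phi from being above it at the infimum s of the
    times at which it is exceeded; a right neighbourhood of s is then free of such times too. *)
Lemma dini_le0 phi : phi 0 <= 0 ->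
  (forall t, 0 <= t -> exists2 D : R,
     h^-1 * (phi (t + h) - phi t) @[h --> 0^'+] --> D & 0 < phi t -> D <= 0) ->
  (forall t, 0 < t -> phi (t - h) @[h --> 0^'+] --> phi t) ->
  forall t, 0 <= t -> phi t <= 0.
Proof.
move=> phi0 rd lc t t0.
suff {t t0} key : forall e, 0 < e -> forall t, 0 <= t -> phi t <= e * (1 + t).
  apply/ler_addgt0Pr => e e0; rewrite add0r.
  have t1 : 0 < 1 + t by lra.
  by have := key (e / (1 + t)) (divr_gt0 e0 t1) t t0; rewrite divfK ?gt_eqF.
move=> e e0 t1 t10; rewrite leNgt; apply/negP => pos1.
pose E := [set t | 0 <= t /\ e * (1 + t) < phi t].
have E0 : E !=set0 by exists t1.
have lE : lbound E 0 by move=> t [].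
have infE : has_inf E by split=> //; exists 0.
pose s := inf E.
have s0 : 0 <= s by apply: lb_le_inf.
have before t : 0 <= t -> t < s -> phi t <= e * (1 + t).
  move=> t0 ts; rewrite leNgt; apply/negP => pt.
  by have := ge_inf infE.2 (conj t0 pt); rewrite leNgt ts.
have phis : phi s <= e * (1 + s).
  move: s0; rewrite le_eqVlt => /predU1P[<-|s0]; first by lra.
  rewrite leNgt; apply/negP => /(cvgr_gt _ (lc s s0)) h1.
  have [h [[hs h0] hs2]] :=
    filter_ex (filterI (filterI h1 (nbhs_right_gt 0)) (nbhs_right_lt s0)).
  have := before (s - h); rewrite subr_ge0 ltrBlDr ltrDl h0 ltW// => /(_ isT isT).
  by move: hs => /=; nra.
have [D rD Dle] := rd s s0.
have [dl dl0 after] : exists2 dl, 0 < dl &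
    forall h, 0 < h < dl -> phi (s + h) <= e * (1 + (s + h)).
  suff [dl dl0 dP] : \forall h \near 0^'+, phi (s + h) <= e * (1 + (s + h)).
    exists dl => // h /andP[h0 hdl]; apply: dP => //=.
    by rewrite sub0r normrN gtr0_norm.
  have [ps|ps] := ltP 0 (phi s).
    have De : D < e by apply: le_lt_trans (Dle ps) e0.
    near=> h; have h0 : 0 < h by near: h; exact: nbhs_right_gt.
    have : h^-1 * (phi (s + h) - phi s) < e.
      by near: h; exact: (cvgr_lt _ rD _ De).
    rewrite mulrC ltr_pdivrMr//; lra.
  (* If phi s <= 0, nothing is known of the sign of D, but the barrier is at least e there and phi
     needs a time of about e / M to reach it. *)
  pose M := `|D| + 1; have M0 : 0 < M by rewrite ltr_wpDl.
  have DM : D < M by rewrite (le_lt_trans (ler_norm D))// ltrDl.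
  near=> h; have h0 : 0 < h by near: h; exact: nbhs_right_gt.
  have : h^-1 * (phi (s + h) - phi s) < M.
    by near: h; exact: (cvgr_lt _ rD _ DM).
  have : h < e / M by near: h; apply: nbhs_right_lt; rewrite divr_gt0.
  rewrite ltr_pdivlMr// mulrC [_^-1 * _]mulrC ltr_pdivrMr// => h1 h2.
  have : 0 <= e * (s + h) by rewrite mulr_ge0 ?addr_ge0// ltW.
  by lra.
have : s + dl <= s.
  apply: lb_le_inf => // t [t0 pt].
  have st : s <= t by apply: ge_inf; [exact: infE.2|].
  rewrite leNgt; apply/negP => tsd.
  move: st; rewrite le_eqVlt => /predU1P[ts|st]; first by move: phis; rewrite ts; lra.
  have := after (t - s); rewrite subr_gt0 st ltrBlDl tsd => /(_ isT).
  by rewrite subrKC leNgt pt.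
by lra.
Unshelve. all: by end_near.
Qed.

Lemma expR_right_derivative (a t : R) :
  h^-1 * (expR (a * (t + h)) - expR (a * t)) @[h --> 0^'+] --> a * expR (a * t).
Proof.
have h : is_derive t 1 (fun x => expR (a * x)) (a * expR (a * t)).
  have da : is_derive t 1 (a \*: (@id R)) (a *: 1) by exact: is_deriveZ.
  have := @is_derive1_comp _ expR (a \*: (@id R)) t _ _ (is_derive_expR _) da.
  by rewrite /GRing.scale/= mulr1 mulrC.
have /cvg_ex[l hl] := @ex_derive _ _ _ _ _ _ _ h.
have <- : l = a * expR (a * t).
  by rewrite -(@derive_val _ _ _ _ _ _ _ h); apply/esym/cvg_lim.
apply: cvg_dnbhs_at_right; apply: cvg_trans hl; apply: near_eq_cvg.
near=> x; rewrite /GRing.scale/= mulr1 [x + t]addrC//.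
Unshelve. all: by end_near.
Qed.

Lemma expR_left_continuous (a t : R) :
  expR (a * (t - h)) @[h --> 0^'+] --> expR (a * t).
Proof.
have -> : expR (a * t) = expR (a * (t - 0)) by rewrite subr0.
apply: cvg_at_right_filter.
apply: (@continuous_comp _ _ _ (fun h => a * (t - h)) expR); last exact: continuous_expR.
apply: cvgM; first exact: cvg_cst.
by apply: cvgB; [exact: cvg_cst|exact: cvg_id].
Qed.

End RealAnalysis.

(** * Monotone integrals of bounded functions *)

Section BoundedIntegrals.
Context {dX : measure_display} {X : measurableType dX} {R : realType}.
Variable mu : probability X R.
Implicit Types (D H : set X) (f g : X -> R).

(* The integral of a nonnegative function is a supremum over the simple
   functions below it, hence monotone on all functions.  This spares the
   measurability of [S |-> split_cell c S T]. *)
Lemma ge0_le_integral_nonmeasurable D (f g : X -> \bar R) :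
  (forall x, D x -> 0 <= f x)%E -> (forall x, D x -> f x <= g x)%E ->
  (\int[mu]_(x in D) f x <= \int[mu]_(x in D) g x)%E.
Proof.
move=> f0 fg; rewrite !ge0_integralE//; last first.
  by move=> x Dx; exact: le_trans (f0 x Dx) (fg x Dx).
apply: le_ereal_sup => _ [h hf <-]; exists h => //= x.
apply: (le_trans (hf x)); rewrite !patchE; case: ifPn => // /set_mem; exact: fg.
Qed.

(** The integral is by definition the difference of those of the positive and negative parts; each
    is monotone without measurability, and boundedness makes both finite. *)
Lemma le_Rintegral_bounded D f g (M : R) : measurable D ->
  (forall x, D x -> `|f x| <= M) -> (forall x, D x -> `|g x| <= M) ->
  (forall x, D x -> f x <= g x) ->
  \int[mu]_(x in D) f x <= \int[mu]_(x in D) g x.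
Proof.
move=> mD fM gM fg.
have fin (h : X -> \bar R) : (forall x, D x -> 0 <= h x <= M%:E)%E ->
    (\int[mu]_(x in D) h x)%E \is a fin_num.
  move=> hM; rewrite ge0_fin_numE; last by apply: integral_ge0 => x /hM /andP[].
  apply: (@le_lt_trans _ _ (\int[mu]_(x in D) (cst M%:E) x)%E).
    by apply: ge0_le_integral_nonmeasurable => x /hM /andP[].
  by rewrite integral_cst// ltey_eq fin_numM// fin_num_measure.
pose fp x := (Num.max (f x) 0)%:E; pose fn x := (Num.max (- f x) 0)%:E.
pose gp x := (Num.max (g x) 0)%:E; pose gn x := (Num.max (- g x) 0)%:E.
have pn (k : X -> R) : (\int[mu]_(x in D) (k x)%:E =
    \int[mu]_(x in D) (Num.max (k x) 0)%:E -
    \int[mu]_(x in D) (Num.max (- k x) 0)%:E)%E.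
  rewrite integralE; congr (_ - _)%E; apply: eq_integral => x _.
    by rewrite funeposE EFin_max.
  by rewrite funenegE EFin_max.
have bd (k : X -> R) x : `|k x| <= M -> (0 <= (Num.max (k x) 0)%:E <= M%:E)%E /\
   (0 <= (Num.max (- k x) 0)%:E <= M%:E)%E.
  rewrite ler_norml !lee_fin !le_max lexx !orbT/= !ge_max => /andP[h1 h2].
  by split; apply/andP; split; lra.
have fpf : (\int[mu]_(x in D) fp x)%E \is a fin_num.
  by apply: fin => x /fM /bd[].
have fnf : (\int[mu]_(x in D) fn x)%E \is a fin_num.
  by apply: fin => x /fM /bd[].
have gpf : (\int[mu]_(x in D) gp x)%E \is a fin_num.
  by apply: fin => x /gM /bd[].
have gnf : (\int[mu]_(x in D) gn x)%E \is a fin_num.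
  by apply: fin => x /gM /bd[].
rewrite /Rintegral pn (pn g) fineB// [leRHS]fineB//.
apply: lerB; (apply: fine_le => //; apply: ge0_le_integral_nonmeasurable => x Dx).
- by rewrite lee_fin le_max lexx orbT.
- by rewrite lee_fin ge_max !le_max fg//= lexx orbT.
- by rewrite lee_fin le_max lexx orbT.
- by rewrite lee_fin ge_max !le_max lerN2 fg//= lexx orbT.
Qed.

(** The comparison functions used with [le_Rintegral_bounded] have this form. *)
Lemma Rintegral_affine_indic D H (b k : R) : measurable D -> measurable H ->
  \int[mu]_(x in D) (b * \1_H x + k) = b * fine (mu (H `&` D)) + k * fine (mu D).
Proof.
move=> mD mH.
have muD : (mu D < +oo)%E by rewrite ltey_eq fin_num_measure.
have iH : mu.-integrable D (EFin \o \1_H).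
  apply: measurable_bounded_integrable => //.
  exists 1; split=> // x x1 y _ /=.
  by rewrite indicE ger0_norm// (le_trans _ (ltW x1))// lern1 leq_b1.
have ik : mu.-integrable D (EFin \o cst k) by exact: finite_measure_integrable_cst.
rewrite RintegralD//; last first.
  exact: (integrableZl mD b iH).
rewrite RintegralZl// Rintegral_cst//; congr (_ * _ + _).
by rewrite /Rintegral integral_indic.
Qed.

End BoundedIntegrals.

Section GeneratorBound.
Variables (R : realType) (d : nat) (kappa : probability (hypersphere R d) R).
Hypothesis d0 : (0 < d)%N.
Variable C : set (sphere R d).
Hypotheses (clC : closed C) (cC : connected C) (C0 : C !=set0).
Implicit Types (T : tessellation R d) (g : tessellation R d -> R).

Definition hit_rate : R := fine (kappa (hits C)).

Definition total_rate T : R :=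
  \sum_(c \in cells T) fine (kappa (hits_int (polytope_set c))).

Lemma total_rate_ge0 T : 0 <= total_rate T.
Proof. by apply: fsumr_ge0 => c _; exact: fine_ge0. Qed.

Lemma total_rate_le T : total_rate T <= (ncells T)%:R.
Proof.
have [finT _ _ _] := tessellationP T.
rewrite /total_rate /ncells fsbig_finite//=.
apply: (@le_trans _ _ (\sum_(c <- fset_set (cells T)) 1)); last first.
  by rewrite big_const_seq count_predT iter_addr addr0.
apply: ler_sum => c _; rewrite -lee_fin fineK ?fin_num_measure//.
  exact: probability_le1 (measurable_hits_int _ d0).
exact: measurable_hits_int.
Qed.

Lemma sum_inside T :
  \sum_(c \in cells T) (\1_[set q : polytope R d | C `<=` (q : set _)°] c : R) =
  \1_(inside C) T.
Proof.
have [finT _ _ _] := tessellationP T.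
have [[c0 Tc0 Cc0]|nT] := pselect (inside C T).
  rewrite [RHS]indicE mem_set; last by exists c0.
  rewrite (fsbigD1 c0)//=.
  rewrite indicE mem_set// fsbig1 ?addr0// => c [Tc cc0].
  rewrite indicE memNset// => Cc.
  by apply: cc0; exact: inside_unique Tc Tc0 Cc Cc0.
rewrite [RHS]indicE memNset// fsbig1// => c Tc.
by rewrite indicE memNset// => Cc; apply: nT; exists c.
Qed.

(** Compared with a 1_I, on which the generator acts as multiplication by -[hit_rate], the remainder
    moves at each split from its value at T to at most b; this costs the total rate times the
    difference. The sign [sg] covers upper and lower estimates at once. *)
Lemma generator_bound g (a b sg : R) T : `|sg| = 1 ->
  (forall T', `|g T'| <= 1) ->
  (forall T', (ncells T' <= ncells T + 2)%N ->
     sg * (g T' - a * \1_(inside C) T') <= b) ->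
  sg * generator kappa g T <= - (sg * (hit_rate * a * \1_(inside C) T)) +
     total_rate T * (b - sg * (g T - a * \1_(inside C) T)).
Proof.
move=> sg1 g1 gb; have [finT _ _ _] := tessellationP T.
pose k := b - sg * (g T - a * \1_(inside C) T).
pose ind c : R := \1_[set q : polytope R d | C `<=` (q : set _)°] c.
have cell c : cells T c ->
    sg * \int[kappa]_(S in hits_int (polytope_set c)) (g (split_cell c S T) - g T)
    <= - (sg * a * hit_rate) * ind c + fine (kappa (hits_int (polytope_set c))) * k.
  move=> Tc.
  have mD := measurable_hits_int (polytope_set c) d0.
  have mH := measurable_hits_closed d0 clC.
  (* When C lies in the interior of c, every hypersphere hitting C belongs to the domain of
     integration; otherwise [ind c] is 0. *)
  have hitE (b' k' : R) :
      b' * ind c * hit_rate + k' * fine (kappa (hits_int (polytope_set c))) =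
      \int[kappa]_(S in hits_int (polytope_set c)) (b' * ind c * \1_(hits C) S + k').
    rewrite Rintegral_affine_indic//; congr (_ + _).
    rewrite /ind indicE; have [Cc|Cc] := pselect (C `<=` (c : set _)°); last first.
      by rewrite memNset// !mulr0 !mul0r.
    rewrite (_ : _ `&` _ = hits C)//.
    apply/seteqP; split=> [S []//|S [x [Sx Cx]]].
    by split; exists x => //; split=> //; exact: Cc.
  have H01 S : 0 <= (\1_(hits C) S : R) <= 1.
    by rewrite indicE ler0n lern1 leq_b1.
  have bndr (b' k' : R) S : `|b' * ind c * \1_(hits C) S + k'| <= `|b' * ind c| + `|k'|.
    rewrite (le_trans (ler_normD _ _))// lerD2r normrM ler_piMr//.
    by have /andP[? ?] := H01 S; rewrite ger0_norm.
  have bndl S : `|g (split_cell c S T) - g T| <= 2.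
    by rewrite (le_trans (ler_normB _ _))// (_ : 2 = 1 + 1)// lerD.
  have pw S : hits_int (polytope_set c) S ->
      sg * (g (split_cell c S T) - g T) <= - (sg * a) * ind c * \1_(hits C) S + k.
    move=> cS; have := gb _ (ncells_split c S T).
    have := inside_split_indic cC C0 Tc cS; rewrite -/(ind c) /k.
    by move=> /eqP; rewrite subr_eq => /eqP ->; lra.
  (* For [sg = -1] the claim becomes a lower bound of the integral, with the coefficients of the
     comparison function negated. *)
  have [sgE|sgE] : sg = 1 \/ sg = -1.
    by move: sg1; case: (ger0P sg) => _ /eqP; [left|right]; lra.
  - rewrite sgE mul1r.
    have := hitE (- (sg * a)) k; rewrite sgE mul1r => hE.
    rewrite [leRHS](_ : _ = - a * ind c * hit_rate +
      k * fine (kappa (hits_int (polytope_set c)))); last by ring.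
    rewrite hE; apply: (@le_Rintegral_bounded _ _ _ _ _ _ _
      (2 + (`|- a * ind c| + `|k|))) => //.
    + by move=> S _; rewrite (le_trans (bndl S))// lerDl addr_ge0.
    + by move=> S _; rewrite (le_trans (bndr _ _ S))// lerDr.
    + by move=> S /pw; rewrite sgE !mul1r.
  - rewrite sgE mulN1r lerNl.
    have := hitE (sg * a) (- k); rewrite sgE mulN1r => hE.
    rewrite [leLHS](_ : _ = - a * ind c * hit_rate +
      (- k) * fine (kappa (hits_int (polytope_set c)))); last by ring.
    rewrite hE; apply: (@le_Rintegral_bounded _ _ _ _ _ _ _
      (2 + (`|- a * ind c| + `|- k|))) => //.
    + by move=> S _; rewrite (le_trans (bndr _ _ S))// lerDr.
    + by move=> S _; rewrite (le_trans (bndl S))// lerDl addr_ge0.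
    + by move=> S /pw; rewrite sgE; lra.
have -> : - (sg * (hit_rate * a * \1_(inside C) T)) =
    - (sg * a * hit_rate) * \1_(inside C) T.
  by ring.
rewrite -/k -sum_inside /generator /total_rate !fsbig_finite//.
rewrite !mulr_sumr mulr_suml -big_split/=.
rewrite big_seq [leRHS]big_seq; apply: ler_sum => c.
by rewrite in_fset_set// => /set_mem; exact: cell.
Qed.

End GeneratorBound.

Section KernelAt.
Context {d d'} {X : measurableType d} {Y : measurableType d'} {R : realType}.
Variable (k : R.-pker X ~> Y) (x : X).
(** A name for [k x] that can carry the structure of a probability measure. *)
Definition kernel_at : set Y -> \bar R := k x.
HB.instance Definition _ := Measure.on kernel_at.
Fact kernel_at_setT : kernel_at setT = 1%E.
Proof. exact: prob_kernel. Qed.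
HB.instance Definition _ := Measure_isProbability.Build _ _ _ kernel_at kernel_at_setT.
End KernelAt.

(** * Transition probabilities *)

Section Semigroup.
Variables (R : realType) (d : nat) (kappa : probability (hypersphere R d) R).
Variable p : R -> R.-pker (tessellation R d) ~> (tessellation R d).
Hypotheses (semi : transition_semigroup p) (gen : has_generator p (generator kappa)).
Variable B : set (tessellation R d).
Hypothesis mB : measurable B.
Implicit Types (T : tessellation R d) (s t h : R).

Definition trans_proba t T : R := fine (kernel_at (p t) T B).

Lemma trans_proba_fin t T : p t T B = (trans_proba t T)%:E.
Proof. by rewrite /trans_proba fineK// fin_num_measure. Qed.

Lemma trans_proba_bound t T : 0 <= trans_proba t T <= 1.
Proof.
rewrite -!lee_fin -trans_proba_fin (measure_ge0 (kernel_at (p t) T))/=.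
by rewrite (@probability_le1 _ _ _ (kernel_at (p t) T)).
Qed.

Lemma trans_proba0 T : trans_proba 0 T = \1_B T.
Proof. by rewrite /trans_proba semi.1// diracE indicE. Qed.

Lemma measurable_trans_proba t : measurable_fun setT (trans_proba t).
Proof.
rewrite (_ : trans_proba t = fine \o (fun T => p t T B))//.
apply: (@measurableT_comp _ _ _ _ _ _ (@fine R) setT (fun T => p t T B)).
  exact: fine_measurable.
exact: measurable_kernel.
Qed.

Lemma chapman_kolmogorov s t T : 0 <= s -> 0 <= t ->
  trans_proba (s + t) T = \int[p s T]_T' trans_proba t T'.
Proof.
move=> s0 t0; rewrite /trans_proba semi.2// /Rintegral; congr fine.
by apply: eq_integral => T' _; exact: trans_proba_fin.
Qed.

Lemma backward_equation t T : 0 <= t ->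
  h^-1 * (trans_proba (t + h) T - trans_proba t T) @[h --> 0^'+] -->
  generator kappa (trans_proba t) T.
Proof.
move=> t0.
have := gen (measurable_trans_proba t).
have M : exists M : R, forall T, `|trans_proba t T| <= M.
  by exists 1 => T'; have /andP[? ?] := trans_proba_bound t T'; rewrite ger0_norm.
move=> /(_ M T); apply: cvg_trans; apply: near_eq_cvg.
(* The short step h comes first, so that p_(t+h) is the integral of p_t against p_h. *)
near=> h; rewrite [t + h]addrC chapman_kolmogorov//.
Unshelve. all: by end_near.
Qed.

(** The difference quotients of the generator at the indicator of {T} converge, so the differences
    themselves tend to 0. *)
Lemma holding_proba T : fine (kernel_at (p h) T [set T]) @[h --> 0^'+] --> (1 : R).
Proof.
have mT := measurable_tessellation1 T.
have m1 : measurable_fun setT (\1_[set T] : tessellation R d -> R).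
  exact: measurable_indic.
have M : exists M : R, forall T', `|\1_[set T] T'| <= M.
  by exists 1 => T'; rewrite indicE ger0_norm// lern1 leq_b1.
have := gen m1; move=> /(_ M T); rewrite indicE mem_set//.
set L := generator _ _ _ => hL.
have : h * (h^-1 * (\int[p h T]_T' \1_[set T] T' - 1)) + 1 @[h --> 0^'+] --> 0 * L + 1.
  apply: cvgD; last exact: cvg_cst.
  by apply: cvgM => //; apply: cvg_at_right_filter; exact: cvg_id.
rewrite mul0r add0r; apply: cvg_trans; apply: near_eq_cvg.
near=> h; have h0 : h != 0 by near: h; exact: nbhs_right_neq.
rewrite mulVKf// subrK /Rintegral integral_indic// setIT//.
Unshelve. all: by end_near.
Qed.

(** The increment is the p_h(T, .)-mean of p_s(T') - p_s(T), which vanishes at T' = T and is at most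
    1 in absolute value elsewhere. The bound does not depend on s, hence its use for left
    continuity. *)
Lemma trans_proba_increment s h T : 0 <= s -> 0 <= h ->
  `|trans_proba (h + s) T - trans_proba s T| <= 1 - fine (kernel_at (p h) T [set T]).
Proof.
move=> s0 h0; rewrite chapman_kolmogorov//; set q := fine _.
have mT := measurable_tessellation1 T.
have aff (b k : R) : b * q + k = \int[kernel_at (p h) T]_T' (b * \1_[set T] T' + k).
  rewrite Rintegral_affine_indic// setIT; congr (_ + _).
  by rewrite probability_setT mulr1.
have /andP[q0 q1] : 0 <= q <= 1.
  rewrite -!lee_fin fineK ?fin_num_measure// measure_ge0/=.
  exact: probability_le1.
have /andP[T0 T1] := trans_proba_bound s T.
have up : \int[kernel_at (p h) T]_T' trans_proba s T' <= (trans_proba s T - 1) * q + 1.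
  rewrite aff; apply: (@le_Rintegral_bounded _ _ _ _ _ _ _ 1) => // T' _.
  - by have /andP[? ?] := trans_proba_bound s T'; rewrite ger0_norm.
  - rewrite indicE; case: (_ \in _); rewrite ?mulr1 ?mulr0 ?add0r ?subrK ?normr1//.
    by rewrite ger0_norm.
  - rewrite indicE; case: (boolP (_ \in _)) => [/set_mem ->|_].
      by rewrite mulr1 subrK.
    by rewrite mulr0 add0r; have /andP[] := trans_proba_bound s T'.
have lo : trans_proba s T * q + 0 <= \int[kernel_at (p h) T]_T' trans_proba s T'.
  rewrite aff; apply: (@le_Rintegral_bounded _ _ _ _ _ _ _ 1) => // T' _.
  - rewrite indicE addr0; case: (_ \in _); rewrite ?mulr1 ?mulr0 ?normr0//.
    by rewrite ger0_norm.
  - by have /andP[? ?] := trans_proba_bound s T'; rewrite ger0_norm.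
  - rewrite indicE addr0; case: (boolP (_ \in _)) => [/set_mem ->|_].
      by rewrite mulr1.
    by rewrite mulr0; have /andP[] := trans_proba_bound s T'.
suff real_bound (f r I : R) : 0 <= f -> f <= 1 -> 0 <= r -> r <= 1 ->
    I <= (f - 1) * r + 1 -> f * r + 0 <= I -> `|I - f| <= 1 - r.
  exact: real_bound up lo.
move=> f0 f1 r0 r1 h1 h2; have : 0 <= f * (1 - r) by apply: mulr_ge0; lra.
have : 0 <= (1 - f) * (1 - r) by apply: mulr_ge0; lra.
by move=> h3 h4; rewrite ler_norml; apply/andP; split; lra.
Qed.

(* [dini_le0] needs left continuity, as right derivatives do not see jumps. *)
Lemma trans_proba_left_continuous t T : 0 < t ->
  trans_proba (t - h) T @[h --> 0^'+] --> trans_proba t T.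
Proof.
move=> t0; apply/cvgrPdist_le => /= e e0; near=> h.
have h0 : 0 < h by near: h; exact: nbhs_right_gt.
have ht : h <= t by near: h; apply: nbhs_right_le.
have := @trans_proba_increment (t - h) h T.
rewrite subr_ge0 => /(_ ht (ltW h0)); rewrite subrKC => /le_trans; apply.
near: h; have /cvgrPdist_le/(_ e e0) := holding_proba T.
by apply: filterS => h; exact: le_trans (ler_norm _).
Unshelve. all: by end_near.
Qed.

End Semigroup.

Section Uniqueness.
Variables (R : realType) (d : nat) (kappa : probability (hypersphere R d) R).
Variable p : R -> R.-pker (tessellation R d) ~> (tessellation R d).
Hypotheses (semi : transition_semigroup p) (gen : has_generator p (generator kappa)).
Hypothesis d0 : (0 < d)%N.
Variable C : set (sphere R d).
Hypotheses (clC : closed C) (cC : connected C) (C0 : C !=set0).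
Implicit Types (T : tessellation R d) (s t h : R).

Let lambda := hit_rate kappa C.
Let g := trans_proba p (inside C).
Let mI : measurable (inside C) := measurable_inside clC.

Lemma frac_le (x y m : R) : 0 < x -> 0 <= m -> x <= y -> x / (x + m) <= y / (y + m).
Proof. by move=> x0 m0 xy; rewrite ler_pdivrMr ?ltr_wpDr// mulrAC ler_pdivlMr; nra. Qed.

(** Write rho and rho' for the fractions at (x, m+1) and (x+2, m). The first part allows a rate to
    be replaced by its bound x in front of rho' - rho; the second says x (rho' - rho) <= 2 rho, and
    this 2 is the exponent in e^(2t). *)
Lemma frac_step (x m : R) : 0 < x -> 0 <= m ->
  x / (x + (m + 1)) <= (x + 2) / (x + 2 + m) /\
  x * ((x + 2) / (x + 2 + m)) <= (x + 2) * (x / (x + (m + 1))).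
Proof.
move=> x0 m0; have d1 : 0 < x + (m + 1) by lra.
have d2 : 0 < x + 2 + m by lra.
split; first by rewrite ler_pdivrMr// mulrAC ler_pdivlMr//; nra.
by rewrite !mulrA [(x + 2) * x]mulrC ler_wpM2l ?mulr_ge0 ?lef_pV2 ?posrE//; lra.
Qed.

(* The jump rate at [T] is at most [n = ncells T] and a split adds at most two
   cells, so that the bound at step [m] is turned by the backward equation into
   the one at step [m + 1]. *)
Lemma trans_proba_error m : forall T t (sg : R), 0 <= t -> `|sg| = 1 ->
  sg * (g t T - expR (- lambda * t) * \1_(inside C) T) <=
  expR (2 * t) * ((ncells T)%:R + 1) / ((ncells T)%:R + 1 + m%:R).
Proof.
have l0 : 0 <= lambda by exact: fine_ge0.
elim: m => [|m ih] T t sg t0 sg1.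
  (* For m = 0 the fraction is 1, and the two compared quantities lie in [0, 1]. *)
  rewrite addr0 mulfK ?gt_eqF ?ltr_wpDl//.
  have e2 : 1 <= expR (2 * t) by rewrite -expR0 ler_expR mulr_ge0.
  apply: le_trans (ler_norm _) _; rewrite normrM sg1 mul1r; apply: le_trans e2.
  have /andP[g0 g1] : 0 <= g t T <= 1 := trans_proba_bound p mI t T.
  have el : expR (- lambda * t) <= 1.
    by rewrite -expR0 ler_expR mulNr oppr_le0 mulr_ge0.
  have := expR_ge0 (- lambda * t); rewrite indicE.
  by case: (_ \in _); rewrite ?mulr1 ?mulr0 => ?; rewrite ler_norml;
    apply/andP; split; lra.
rewrite -mulrA; set x := (ncells T)%:R + 1; set rho := x / _.
have x0 : 1 <= x by rewrite lerDr.
have m0 : 0 <= m%:R :> R by [].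
have x_gt0 : 0 < x := lt_le_trans ltr01 x0.
have rho0 : 0 < rho by apply: divr_gt0 => //; apply: ltr_wpDr.
pose i : R := \1_(inside C) T.
pose phi t := sg * (g t T - expR (- lambda * t) * i) - expR (2 * t) * rho.
suff : phi t <= 0 by rewrite /phi subr_le0.
move: t t0; apply: dini_le0.
- by rewrite /phi /g trans_proba0//= !mulr0 expR0 !mul1r subrr mulr0 sub0r oppr_le0 ltW.
- move=> t t0.
  exists (sg * (generator kappa (g t) T - - lambda * expR (- lambda * t) * i)
          - 2 * expR (2 * t) * rho).
    have := @backward_equation _ _ _ _ semi gen _ mI t T t0; rewrite -/g => dg.
    have da := @expR_right_derivative R (- lambda) t.
    have db := @expR_right_derivative R 2 t.
    rewrite (_ : (fun h => _) = (fun h => sg * (h^-1 * (g (t + h) T - g t T) -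
      h^-1 * (expR (- lambda * (t + h)) - expR (- lambda * t)) * i) -
      h^-1 * (expR (2 * (t + h)) - expR (2 * t)) * rho)); last first.
      by apply/funext => h; rewrite /phi; ring.
    apply: cvgB; last by apply: cvgM db _; exact: cvg_cst.
    apply: cvgM; first exact: cvg_cst.
    by apply: cvgB dg _; apply: cvgM da _; exact: cvg_cst.
  rewrite /phi subr_gt0 => phit.
  pose b := expR (2 * t) * ((x + 2) / (x + 2 + m%:R)).
  have gb := @generator_bound _ _ kappa d0 _ clC cC C0 (g t)
    (expR (- lambda * t)) b sg T sg1.
  have {gb} := gb _ _; rewrite -/lambda -/i => gb.
  have {gb} : sg * generator kappa (g t) T <=
      - (sg * (lambda * expR (- lambda * t) * i)) +
      total_rate kappa T * (b - sg * (g t T - expR (- lambda * t) * i)).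
    apply: gb => T'.
      by have /andP[? ?] := trans_proba_bound p mI t T'; rewrite ger0_norm.
    move=> T'T; apply: le_trans (ih T' t sg t0 sg1) _.
    rewrite /b -mulrA ler_wpM2l ?expR_ge0//; apply: frac_le => //.
    by rewrite /x addrAC lerD2r -natrD ler_nat.
  have r0 := total_rate_ge0 kappa T.
  have rx : total_rate kappa T <= x.
    by rewrite (le_trans (total_rate_le _ d0 _))// /x lerDl.
  rewrite /b; move: phit (expR_gt0 (2 * t)) r0 rx.
  set r := total_rate _ _; set G := generator _ _ _; set e := expR (2 * t).
  set w := sg * (_ - _); set rho' := _ / _ => we e0 r0 rx Gle.
  have [rr xr] := frac_step x_gt0 m0; rewrite natr1 -/rho -/rho' in rr xr.
  (* Where phi is positive, w exceeds e rho, so that r (e rho' - w) <= r e (rho' - rho) <= x e (rho'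
     - rho) <= 2 e rho: exactly the derivative of the bound. The terms in lambda cancel. *)
  have : r * (e * rho' - w) <= r * (e * (rho' - rho)).
    by rewrite ler_wpM2l// mulrBr lerB// ltW.
  have : r * (e * (rho' - rho)) <= x * (e * (rho' - rho)).
    by rewrite ler_wpM2r// mulr_ge0 ?subr_ge0// ltW.
  have : 0 <= e * ((x + 2) * rho - x * rho') by rewrite mulr_ge0 ?subr_ge0// ltW.
  move: we Gle rr xr; clearbody e w rho'; lra.
- move=> t t0; apply: cvgB; last first.
    by apply: cvgM; [exact: expR_left_continuous|exact: cvg_cst].
  apply: cvgM; first exact: cvg_cst.
  apply: cvgB; first exact: (trans_proba_left_continuous semi gen mI).
  by apply: cvgM; [exact: expR_left_continuous|exact: cvg_cst].
Qed.

Lemma trans_proba_inside T t : 0 <= t ->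
  g t T = expR (- lambda * t) * \1_(inside C) T.
Proof.
move=> t0; apply/eqP; rewrite -subr_eq0 -normr_le0.
set w := g t T - _; pose x : R := (ncells T)%:R + 1.
have x0 : 0 < x by rewrite ltr_wpDl.
have wle m : `|w| <= expR (2 * t) * x / (x + m%:R).
  have [_|_] := ger0P w.
    by have := trans_proba_error m T t0 (normr1 R); rewrite mul1r.
  have := @trans_proba_error m T t (-1) t0; rewrite normrN1 mulN1r; exact.
rewrite leNgt; apply/negP => w0.
(* A nonzero difference w is refuted by some m above e^(2t) x / |w|. *)
have := archi_boundP (ltW (divr_gt0 (mulr_gt0 (expR_gt0 (2 * t)) x0) w0)).
set m := Num.bound _; rewrite ltr_pdivrMr// => h.
have xm : 0 < x + m%:R by apply: ltr_wpDr.
have := wle m; apply/negP; rewrite -ltNge ltr_pdivrMr//.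
by apply: (lt_trans h); rewrite mulrDr [_ * m%:R]mulrC ltrDr mulr_gt0.
Qed.

End Uniqueness.

(** * Avoidance probabilities *)

Lemma closed_sphere1 (R : realType) (d : nat) (z : sphere R d) : closed [set z].
Proof.
rewrite (_ : [set z] = (fun y => dotv (\val z) (\val y)) @^-1` [set r | 1 <= r]).
  apply: closed_comp; last exact: closed_ge.
  by move=> y _; exact: continuous_dotv_val.
apply/seteqP; split=> [_ ->|y /= zy]; first by rewrite /= dotv_val.
apply: val_inj; apply/eqP; rewrite -subr_eq0 -dotv_eq0 eq_le dotv_ge0 andbT.
by rewrite !dotvE !dotv_val (dotvC (\val y)); lra.
Qed.

Section AvoidanceProbability.
Variables (R : realType) (d : nat) (kappa : probability (hypersphere R d) R).
Context {dO : measure_display} {Omega : measurableType dO}.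
Variables (P : probability Omega R) (Y : R -> Omega -> tessellation R d).
Variable T0 : tessellation R d.
Hypothesis hY : splitting_process P Y kappa T0.
Hypothesis d0 : (0 < d)%N.
Implicit Types (C : set (sphere R d)) (t : R).

Lemma measurable_process t : 0 <= t -> measurable_fun setT (Y t).
Proof. by have [_ _ [p [_ _ [mY _]]]] := hY; exact: mY. Qed.

(** The Markov property from time 0 makes this the mean of p_t(Y_0, I), and Y_0 is almost surely
    [T0]. *)
Lemma process_inside C t : closed C -> connected C -> C !=set0 ->
  inside C T0 -> 0 <= t ->
  P (Y t @^-1` inside C) = (expR (- (hit_rate kappa C * t)))%:E.
Proof.
move=> clC cC C0 CT0 t0; have [Y0 _ [p [semi gen [mY markov]]]] := hY.
have mI := measurable_inside clC.
have := markov 0 t (lexx 0) t0 setT (inside C) _ mI.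
rewrite add0r setTI => ->; last first.
  apply: sub_sigma_algebra; exists 0, setT; split; rewrite ?preimage_setT//.
  by rewrite lexx.
transitivity (\int[P]_w (cst (p t T0 (inside C)) w))%E.
  apply: ae_eq_integral => //.
  - apply: (@measurableT_comp _ _ _ _ _ _ (fun T => p t T (inside C)) setT (Y 0)).
      exact: measurable_kernel.
    exact: mY.
  - by apply: filterS Y0 => w /= -> _.
rewrite integral_cst// (_ : (_ * _)%E = p t T0 (inside C)); last first.
  by rewrite -[RHS]mule1; congr (_ * _)%E; exact: probability_setT.
rewrite (trans_proba_fin p mI).
rewrite (trans_proba_inside semi gen d0 clC cC C0 T0 t0) indicE mem_set// mulr1.
by rewrite mulNr.
Qed.

Lemma avoid_event C t : closed C -> connected C -> C !=set0 ->
  [set w | skeleton (Y t w) `&` C = set0] = Y t @^-1` inside C.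
Proof.
by move=> clC cC C0; apply/seteqP; split=> w /= /(inside_skeleton (Y t w) clC cC C0).
Qed.

Lemma avoid_connected C t : closed C -> connected C ->
  (exists2 c : polytope R d, cells T0 c & C `<=` (c : set _)°) -> 0 <= t ->
  avoid_proba P Y t C = (expR (- (fine (kappa (hits C)) * t)))%:E.
Proof.
(* The empty set is surely avoided and hit by no hypersphere; it is set apart because the
   description by [inside] needs a point of C. *)
move=> clC cC CT0 t0; have [C0|/set0P C0] := eqVneq C set0; last first.
  by rewrite /avoid_proba avoid_event//; exact: process_inside.
rewrite /avoid_proba C0 (_ : [set w | _] = setT); last first.
  by apply/seteqP; split=> // w _ /=; rewrite setI0.
rewrite probability_setT (_ : hits set0 = set0); last first.
  by apply/seteqP; split=> // S [x []].
by rewrite measure0/= mul0r oppr0 expR0.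
Qed.

(* An antipodal pair is a polytope but not connected; it is handled through its
   points, which regularity makes almost surely avoided. *)
Lemma avoid_antipodal (x y : sphere R d) t : \val y = - \val x -> regular kappa ->
  (exists2 c : polytope R d, cells T0 c & [set x; y] `<=` (c : set _)°) ->
  0 <= t ->
  avoid_proba P Y t [set x; y] =
    (expR (- (fine (kappa (hits [set x; y])) * t)))%:E.
Proof.
move=> yx reg [c Tc xyc] t0.
have hitx z : hits [set z] = [set S : hypersphere R d | (S : set _) z].
  apply/seteqP; split=> [S [v [Sv vz]]|S Sz]; first by rewrite /= -vz.
  by exists z.
have P1 (z : sphere R d) : [set x; y] z -> P (Y t @^-1` inside [set z]) = 1%E.
  move=> xyz; rewrite process_inside//.
  - by rewrite /hit_rate hitx reg mul0r oppr0 expR0.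
  - exact: closed_sphere1.
  - exact: connected1.
  - by exists z.
  - by exists c => // _ ->; exact: xyc.
have mY := measurable_process t0.
have mz (z : sphere R d) : measurable (Y t @^-1` inside [set z]).
  rewrite -[X in measurable X]setTI; apply: mY => //.
  exact: (measurable_inside (@closed_sphere1 _ _ z)).
(* A hypersphere contains both points of an antipodal pair or neither, so the rate is that of a
   single point, namely 0. *)
have -> : hits [set x; y] = hits [set x].
  apply/seteqP; split=> S [z [Sz zE]]; exists x; last first.
    by split; [move: Sz; have -> : z = x := zE|left].
  split=> //; case: zE Sz => -> //; have [u u0 ->] := hypersphereP S.
  by rewrite /= yx dotvNr => /eqP; rewrite oppr_eq0 => /eqP.
rewrite hitx reg/= mul0r oppr0 expR0.
have -> : avoid_proba P Y t [set x; y] =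
    P (Y t @^-1` inside [set x] `&` Y t @^-1` inside [set y]).
  have ev z := @avoid_event [set z] t (@closed_sphere1 _ _ z) (@connected1 _ z)
    (ex_intro _ z erefl).
  congr (P _); rewrite -!ev.
  apply/seteqP; split=> w /=; rewrite setIUr.
    by rewrite setU_eq0.
  by move=> [-> ->]; rewrite setU0.
(* The event for x exceeds the joint event by a part of the complement of the event for y, which is
   null. *)
rewrite -[RHS](P1 x); last by left.
apply/esym; apply: (etrans (measureDI P (mz x) (mz y))).
rewrite -[RHS]add0e; congr (_ + _)%E.
apply/eqP; rewrite eq_le measure_ge0 andbT.
apply: (@le_trans _ _ (P (~` (Y t @^-1` inside [set y])))).
  apply: le_measure; rewrite ?inE; last by move=> w [].
  - by apply/mem_set; apply: measurableD; exact: mz.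
  - by apply/mem_set; apply: measurableC; exact: mz.
by rewrite probability_setC// P1 ?subee//; right.
Qed.

End AvoidanceProbability.

(** * The measure of the hyperspheres hitting an arc *)

Lemma additive_on_segment (R : realType) (L : R) (m : R -> R) : 0 < L ->
  (forall a b, 0 <= a -> 0 <= b -> a + b <= L -> m (a + b) = m a + m b) ->
  m L = 1 -> (forall s, 0 <= s <= L -> 0 <= m s <= 1) ->
  forall s, 0 <= s <= L -> m s = s / L.
Proof.
move=> L0 madd mL m01 s sL; apply/eqP; rewrite -subr_eq0 -normr_le0.
(* An additive defect vanishing at L is symmetric about L/2 up to sign and
   doubles with its argument, so that its bound halves at each step. *)
have halve n : forall s, 0 <= s <= L -> `|m s - s / L| * 2 ^+ n <= 1.
  elim: n => [|n ih] {}s /andP[s0 {}sL].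
    have s0L : 0 <= s <= L by rewrite s0.
    have /andP[ms0 ms1] := m01 s s0L.
    have q0 : 0 <= s / L by rewrite divr_ge0// ltW.
    have q1 : s / L <= 1 by rewrite ler_pdivrMr ?mul1r.
    by rewrite mulr1 ler_norml; apply/andP; split; lra.
  have low r : 0 <= r -> r <= L / 2 -> `|m r - r / L| * 2 ^+ n.+1 <= 1.
    move=> r0 rL; have := ih (r + r); rewrite madd//; last by lra.
    have -> : m r + m r - (r + r) / L = 2 * (m r - r / L) by rewrite mulrDl; ring.
    rewrite normrM ger0_norm// -mulrA mulrCA -exprS; apply.
    by apply/andP; split; lra.
  have [?|?] := leP s (L / 2); first exact: low.
  have ms : m L = m s + m (L - s) by rewrite -madd ?subrKC//; lra.
  have -> : m s - s / L = - (m (L - s) - (L - s) / L).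
    rewrite mulrBl divff ?gt_eqF// (_ : m (L - s) = 1 - m s); first by ring.
    by move: ms; rewrite mL; lra.
  by rewrite normrN; apply: low; lra.
rewrite leNgt; apply/negP => e0.
have [n] : exists n, 1 / `|m s - s / L| < 2 ^+ n.
  have := archi_boundP (ltW (divr_gt0 ltr01 e0)); set k := Num.bound _ => h.
  exists k; apply: (lt_trans h); rewrite -natrX ltr_nat; exact: ltn_expl.
by rewrite ltr_pdivrMr// mulrC ltNge halve.
Qed.

Section SphereMaps.
Variables (R : realType) (d : nat).

Lemma continuous_to_sphere (X : topologicalType) (f : X -> sphere R d) :
  (forall w, continuous (fun t => dotv w (\val (f t)))) -> continuous f.
Proof.
move=> cf t A /nbhs_sphereP[e e0 eA].
have : 1 - e < dotv (\val (f t)) (\val (f t)) by rewrite dotv_val; lra.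
by move=> /(cvgr_gt _ (cf (\val (f t)) t)); apply: filterS => s; exact: eA.
Qed.

Lemma hausdorff_sphere : hausdorff_space (sphere R d).
Proof.
move=> x y xy; apply: val_inj; apply/eqP; rewrite -subr_eq0 -dotv_eq0.
rewrite eq_le dotv_ge0 andbT leNgt; apply/negP.
rewrite !dotvE !dotv_val (dotvC (\val y)) => h.
pose c := (1 + dotv (\val x) (\val y)) / 2.
have xc : c < dotv (\val x) (\val x) by rewrite dotv_val /c; lra.
have yc : dotv (\val x) (\val y) < c by rewrite /c; lra.
have nx : nbhs x [set z | c < dotv (\val x) (\val z)].
  exact: (cvgr_gt _ (@continuous_dotv_val _ _ (\val x) x) _ xc).
have ny : nbhs y [set z | dotv (\val x) (\val z) < c].
  exact: (cvgr_lt _ (@continuous_dotv_val _ _ (\val x) y) _ yc).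
by have [z [/= /lt_trans h1 /h1]] := xy _ _ nx ny; rewrite ltxx.
Qed.

Lemma path_closed_connected (f : R -> sphere R d) (a b : R) : continuous f ->
  closed (f @` `[a, b]) /\ connected (f @` `[a, b]).
Proof.
move=> cf; have wf : {within `[a, b], continuous f} by exact: continuous_subspaceT.
split.
  apply: compact_closed; first exact: hausdorff_sphere.
  by apply: continuous_compact => //; exact: segment_compact.
by apply: connected_continuous_connected => //; exact: segment_connected.
Qed.

End SphereMaps.

(** * Great circles and the rotations of their plane *)

Section GreatCircle.
Variables (R : realType) (d : nat) (x : sphere R d) (v : 'rV[R]_d.+1).
Hypotheses (vv : dotv v v = 1) (xv : dotv (\val x) v = 0).
Implicit Types (a b s t th : R) (y : 'rV[R]_d.+1) (S : hypersphere R d).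

Definition circle_point s := cos s *: \val x + sin s *: v.

(** Normalisation by [direction] gives a point of the sphere without a proof in the term; for
    orthonormal x and v it changes nothing. *)
Definition great_circle s : sphere R d := direction (circle_point s).

Definition circle_arc a b : set (sphere R d) := great_circle @` `[a, b].

Lemma val_great_circle s : \val (great_circle s) = circle_point s.
Proof.
have cc : dotv (circle_point s) (circle_point s) = 1.
  rewrite /circle_point !dotvE dotv_val vv (dotvC v) xv -[RHS](cos2Dsin2 s).
  by ring.
rewrite val_direction ?cc ?sqrtr1 ?invr1 ?scale1r//.
by rewrite -dotv_eq0 cc oner_eq0.
Qed.

Lemma dotv_great_circle y s :
  dotv y (\val (great_circle s)) = cos s * dotv y (\val x) + sin s * dotv y v.
Proof. by rewrite val_great_circle !dotvE. Qed.

Lemma continuous_great_circle : continuous great_circle.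
Proof.
apply: continuous_to_sphere => y.
rewrite (_ : (fun t => _) = fun t => cos t * dotv y (\val x) + sin t * dotv y v).
  move=> s; apply: cvgD; apply: cvgM; try exact: cvg_cst.
    exact: continuous_cos.
  exact: continuous_sin.
by apply/funext => t; exact: dotv_great_circle.
Qed.

Lemma great_circle0 : great_circle 0 = x.
Proof.
apply: val_inj; rewrite val_great_circle /circle_point cos0 sin0.
by rewrite scale1r scale0r addr0.
Qed.

(** The end points are antipodal, so the linear form of S takes opposite values there and vanishes
    in between. *)
Lemma hits_half_circle : hits (circle_arc 0 pi) = setT.
Proof.
apply/seteqP; split=> // S _; have [u u0 SE] := hypersphereP S.
pose f s := dotv u (\val (great_circle s)).
have cf : continuous f.
  move=> s; apply: (@continuous_comp _ _ _ great_circle (fun z => dotv u (\val z))).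
    exact: continuous_great_circle.
  exact: continuous_dotv_val.
have [|s sI fs] := @IVT R f 0 pi 0 (pi_ge0 R) (continuous_subspaceT cf).
  rewrite /f !dotv_great_circle cos0 sin0 cospi sinpi !mul0r !addr0 mul1r mulN1r.
  by rewrite ge_min le_max oppr_le0 oppr_ge0 [_ || (0 <= _)]orbC !le_total.
by exists (great_circle s); split; [rewrite SE|exists s].
Qed.

Lemma hits_arcU a b : 0 <= a -> 0 <= b ->
  hits (circle_arc 0 (a + b)) = hits (circle_arc 0 a) `|` hits (circle_arc a (a + b)).
Proof.
move=> a0 b0; apply/seteqP; split=> S.
  move=> [z [Sz [s + sz]]]; rewrite /= in_itv/= => /andP[s0 sab].
  have [sa|sa] := leP s a; [left|right]; exists z; split=> //;
    by exists s => //; rewrite /= in_itv/= ?s0 ?sa ?(ltW sa).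
move=> [|] [z [Sz [s + sz]]]; rewrite /= in_itv/= => /andP[s0 sab];
  exists z; split=> //; exists s => //; rewrite /= in_itv/=.
  by rewrite s0 (le_trans sab)// lerDl.
by rewrite sab (le_trans a0).
Qed.

(** A linear form vanishing at angles s < a < t with t - s < pi vanishes on the whole circle, in
    particular at x. The only other possibility is s = 0 and t = pi, when S passes through x
    anyway. *)
Lemma hits_arcI a b : 0 <= a -> 0 <= b -> a + b <= pi ->
  hits (circle_arc 0 a) `&` hits (circle_arc a (a + b)) `<=`
  hits [set great_circle a] `|` hits [set x].
Proof.
move=> a0 b0 abpi S [[z [Sz [s + sz]]]] [w [Sw [t + tw]]].
rewrite /= !in_itv/= => /andP[s0 sa] /andP[ta tab]; rewrite -{}sz -{}tw in Sz Sw.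
have [sE|sna] := eqVneq s a.
  by left; exists (great_circle a); split=> //; rewrite -sE.
have [tE|tna] := eqVneq t a.
  by left; exists (great_circle a); split=> //; rewrite -tE.
right; exists x; split=> //; have [u u0 SE] := hypersphereP S.
move: Sz Sw; rewrite SE/= !dotv_great_circle.
set A := dotv u (\val x); set B := dotv u v => us ut.
have sa' : s < a by rewrite lt_def eq_sym sna.
have ta' : a < t by rewrite lt_def tna.
have [tspi|tspi] := eqVneq (t - s) pi.
  have sE : s = 0 by lra.
  by move: us; rewrite sE cos0 sin0 mul1r mul0r addr0.
have st : 0 < sin (t - s).
  apply: sin_gt0_pi; rewrite subr_gt0 (lt_trans sa' ta')/= lt_neqAle tspi/=; lra.
have : sin (t - s) * A = 0.
  have -> : sin (t - s) * A =
      sin t * (cos s * A + sin s * B) - sin s * (cos t * A + sin t * B).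
    by rewrite sinB; ring.
  by rewrite us ut !mulr0 subrr.
by move=> /eqP; rewrite mulf_eq0 gt_eqF//= => /eqP.
Qed.

(** Acting on row vectors from the right: rotation by [th] in the plane of x and v, identity on its
    orthogonal complement. *)
Definition plane_rotation th : 'M[R]_d.+1 :=
  1%:M + (cos th - 1) *: ((\val x)^T *m \val x + v^T *m v)
       + sin th *: ((\val x)^T *m v - v^T *m \val x).

Lemma mulmx_plane_rotation y th : y *m plane_rotation th =
  y + (cos th - 1) *: (dotv y (\val x) *: \val x + dotv y v *: v)
    + sin th *: (dotv y (\val x) *: v - dotv y v *: \val x).
Proof.
have outer (p q : 'rV[R]_d.+1) : y *m (p^T *m q) = dotv y p *: q.
  by rewrite mulmxA [y *m p^T]mx11_scalar -dotv_mx mul_scalar_mx.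
by rewrite /plane_rotation !mulmxDr mulmx1 -!scalemxAr !mulmxDr mulmxN !outer.
Qed.

Lemma circle_point_rotation s th :
  circle_point s *m plane_rotation th = circle_point (th + s).
Proof.
rewrite mulmx_plane_rotation /circle_point !dotvE dotv_val vv (dotvC v) xv cosD sinD.
apply/rowP => i; rewrite !mxE; ring.
Qed.

Lemma plane_rotationD th ph :
  plane_rotation th *m plane_rotation ph = plane_rotation (th + ph).
Proof.
apply/row_matrixP => i; rewrite !rowE mulmxA; set y := delta_mx _ _.
rewrite !mulmx_plane_rotation !dotvE dotv_val vv (dotvC v) xv cosD sinD.
apply/rowP => j; rewrite !mxE; ring.
Qed.

Lemma plane_rotation0 : plane_rotation 0 = 1%:M.
Proof. by rewrite /plane_rotation cos0 sin0 subrr !scale0r !addr0. Qed.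

Lemma trmx_plane_rotation th : (plane_rotation th)^T = plane_rotation (- th).
Proof.
rewrite /plane_rotation cosN sinN; apply/matrixP => i j.
by rewrite !mxE !big_ord1 !mxE (eq_sym i j); ring.
Qed.

Lemma plane_rotation_orthogonal th :
  plane_rotation th *m (plane_rotation th)^T = 1%:M.
Proof. by rewrite trmx_plane_rotation plane_rotationD subrr plane_rotation0. Qed.

(** Orthogonality leaves 1 and -1; a rotation by [th] is the square of one by [th / 2], which
    excludes -1. *)
Lemma det_plane_rotation th : \det (plane_rotation th) = 1.
Proof.
have : \det (plane_rotation th) ^+ 2 = 1.
  by rewrite expr2 -{2}det_tr -det_mulmx plane_rotation_orthogonal det1.
have : 0 <= \det (plane_rotation th).
  have -> : th = th / 2 + th / 2 by field.
  by rewrite -plane_rotationD det_mulmx -expr2 sqr_ge0.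
by move=> ? /eqP; rewrite sqrf_eq1 => /orP[/eqP//|/eqP]; lra.
Qed.

Lemma hits_arc_rotate a b :
  [set S : hypersphere R d | exists2 S' : hypersphere R d,
     hits (circle_arc 0 b) S' & (S : set _) = rotate (plane_rotation a) S'] =
  hits (circle_arc a (a + b)).
Proof.
apply/seteqP; split=> S.
  move=> [S' [z [Sz [s + sz]]] SE]; rewrite /= in_itv/= => /andP[s0 sb].
  rewrite -{}sz in Sz.
  exists (great_circle (a + s)); split; last first.
    by exists (a + s) => //; rewrite /= in_itv/= lerDl lerD2l s0.
  rewrite SE; exists (great_circle s) => //.
  by rewrite !val_great_circle circle_point_rotation.
move=> [z [Sz [s + sz]]]; rewrite /= in_itv/= => /andP[s0 sb]; rewrite -{}sz in Sz.
have [u u0 SE] := hypersphereP S.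
set O := plane_rotation a; have OO : O *m O^T = 1%:M := plane_rotation_orthogonal a.
have OO' : O^T *m O = 1%:M by exact: mulmx1C.
have dotO p q : dotv (p *m O^T) q = dotv p (q *m O).
  by rewrite !dotv_mx trmx_mul mulmxA.
(* The hypersphere that is rotated onto S is the one whose normal is u rotated back. *)
have hS' : is_hypersphere [set z : sphere R d | dotv (u *m O^T) (\val z) = 0].
  apply/is_hypersphereP; exists (u *m O^T) => //; apply: contraNneq u0 => uO.
  by rewrite -(mulmx1 u) -OO' mulmxA uO mul0mx.
exists (Hypersphere (asboolT hS')) => /=.
  exists (great_circle (s - a)); split.
    move: Sz; rewrite SE/= dotO !val_great_circle circle_point_rotation.
    by rewrite subrKC.
  by exists (s - a) => //; rewrite /= in_itv/= subr_ge0 s0 lerBlDl.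
rewrite SE; apply/seteqP; split=> [q /= uq|q [y /= + qE]]; last first.
  by rewrite dotO -qE.
have qO1 : dotv (\val q *m O^T) (\val q *m O^T) = 1.
  by rewrite dotO -mulmxA OO' mulmx1 dotv_val.
have qO0 : \val q *m O^T != 0 by rewrite -dotv_eq0 qO1 oner_eq0.
have dE : \val (direction (\val q *m O^T)) = \val q *m O^T.
  by rewrite val_direction// qO1 sqrtr1 invr1 scale1r.
exists (direction (\val q *m O^T)); rewrite /= dE ?dotO -mulmxA OO' mulmx1//.
Qed.

Variable mu : probability (hypersphere R d) R.
Hypotheses (d0 : (0 < d)%N) (mu_rot : rotation_invariant mu) (mu_reg : regular mu).

Lemma closed_arc a b : closed (circle_arc a b).
Proof. exact: (path_closed_connected a b continuous_great_circle).1. Qed.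

Lemma connected_arc a b : connected (circle_arc a b).
Proof. exact: (path_closed_connected a b continuous_great_circle).2. Qed.

Lemma measurable_hits_arc a b : measurable (hits (circle_arc a b)).
Proof. by apply: measurable_hits_closed => //; exact: closed_arc. Qed.

Lemma hits_sphere1_null (z : sphere R d) : mu (hits [set z]) = 0%E.
Proof.
rewrite -(mu_reg z); congr (mu _); apply/seteqP; split=> [S [w [Sw wz]]|S Sz].
  by rewrite /= -wz.
by exists z.
Qed.

(** Rotation invariance moves the second arc next to the first. A hypersphere hitting both passes
    through one of two fixed points by [hits_arcI], a null event by regularity. *)
Lemma hits_arc_additive a b : 0 <= a -> 0 <= b -> a + b <= pi ->
  mu (hits (circle_arc 0 (a + b))) =
  (mu (hits (circle_arc 0 a)) + mu (hits (circle_arc 0 b)))%E.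
Proof.
move=> a0 b0 abpi; have mh := measurable_hits_arc.
have m1 (z : sphere R d) : measurable (hits [set z]).
  by apply: measurable_hits_closed => //; exact: closed_sphere1.
have -> : mu (hits (circle_arc 0 b)) = mu (hits (circle_arc a (a + b))).
  rewrite -hits_arc_rotate mu_rot//; first exact: plane_rotation_orthogonal.
  exact: det_plane_rotation.
rewrite hits_arcU// measureUfinl//; last by rewrite ltey_eq fin_num_measure.
rewrite [X in (_ - X)%E](_ : _ = 0%E) ?sube0//.
apply/eqP; rewrite eq_le measure_ge0 andbT.
have <- : mu (hits [set great_circle a] `|` hits [set x]) = 0%E.
  by apply: null_set_setU => //; exact: hits_sphere1_null.
apply: le_measure; last exact: hits_arcI.
  by apply/mem_set; exact: measurableI.
by apply/mem_set; exact: measurableU.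
Qed.

Lemma hits_arc_measure s : 0 <= s <= pi -> fine (mu (hits (circle_arc 0 s))) = s / pi.
Proof.
have fn t : mu (hits (circle_arc 0 t)) \is a fin_num.
  by apply: fin_num_measure; exact: measurable_hits_arc.
apply: (@additive_on_segment R pi (fun s => fine (mu (hits (circle_arc 0 s))))).
- exact: pi_gt0.
- by move=> a b a0 b0 ab; rewrite hits_arc_additive// fineD.
- by rewrite hits_half_circle probability_setT.
- move=> t _; rewrite -!lee_fin fineK// measure_ge0/=.
  by apply: probability_le1; exact: measurable_hits_arc.
Qed.

End GreatCircle.

(** * Connectedness of polytopes *)

Section PolytopesConnected.
Variables (R : realType) (d : nat).
Implicit Types (x y z : sphere R d) (C : polytope R d).

(** Non-antipodal points of a polytope are joined within it by the shorter great arc, as a convex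
    cone contains all nonnegative combinations of x and y. *)
Lemma polytope_component C x y : polytope_set C x -> polytope_set C y ->
  \val y != - \val x -> connected_component (polytope_set C) x y.
Proof.
move=> Cx Cy yNx; have [->|xy] := eqVneq y x.
  by exists [set x]; [split=> //; [move=> _ ->|exact: connected1]|].
pose th := geod x y; have cth : cos th = dotv (\val x) (\val y) := cos_geod x y.
have s2 : sin th ^+ 2 = 1 - cos th ^+ 2 by rewrite -(cos2Dsin2 th); ring.
have th0 : 0 <= th := geod_ge0 x y.
have thpi : th <= pi := geod_lepi x y.
have sth : 0 < sin th.
  rewrite lt_def sin_ge0_pi ?th0// andbT -sqrf_eq0 s2 cth.
  rewrite -{1}(expr1n _ 2) subr_sqr mulf_eq0 negb_or; apply/andP; split.
    apply: contraNneq xy => h; apply/eqP/val_inj/eqP.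
    rewrite -subr_eq0 -dotv_eq0 !dotvE !dotv_val (dotvC (\val y)); apply/eqP; lra.
  apply: contraNneq yNx => h.
  rewrite -subr_eq0 -dotv_eq0 !dotvE !dotv_val (dotvC (\val y)); apply/eqP; lra.
(* The unit tangent vector at x towards y, by Gram-Schmidt; its norm is 1 since sin th is
   positive. *)
pose v := (sin th)^-1 *: (\val y - cos th *: \val x).
have vv : dotv v v = 1.
  rewrite /v !dotvE !dotv_val (dotvC (\val y)) -cth.
  transitivity ((1 - cos th ^+ 2) / sin th ^+ 2); first by field; rewrite gt_eqF.
  by rewrite -s2 divff// sqrf_eq0 gt_eqF.
have xv : dotv (\val x) v = 0.
  by rewrite /v !dotvE dotv_val -cth mulr1 subrr mulr0.
have yE : great_circle x v th = y.
  apply: val_inj; rewrite val_great_circle// /circle_point /v scalerA divff ?gt_eqF//.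
  by rewrite scale1r addrC subrK.
exists (circle_arc x v 0 th); last by exists th; rewrite //= in_itv/= th0 lexx.
split; last exact: connected_arc.
  by exists 0; [rewrite /= in_itv/= lexx|exact: great_circle0].
have [_ [us us0 CE]] := polytopeP C; rewrite CE in Cx Cy *.
move=> _ [s + <-] u uus; rewrite /= in_itv/= => /andP[s0 sth'].
have ux := Cx u uus; have uy := Cy u uus; rewrite /half_sphere/= in ux uy *.
rewrite dotv_great_circle// /v dotvZr dotvDr dotvNr dotvZr.
(* Spherical interpolation: the point at angle s is (sin (th - s) x + sin s y) / sin th, with
   nonnegative coefficients. *)
have -> : cos s * dotv u (\val x) +
    sin s * ((sin th)^-1 * (dotv u (\val y) - cos th * dotv u (\val x))) =
    (sin th)^-1 * (sin (th - s) * dotv u (\val x) + sin s * dotv u (\val y)).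
  by rewrite sinB; field; rewrite gt_eqF.
rewrite mulr_ge0 ?invr_ge0 ?(ltW sth)// addr_ge0// mulr_ge0// sin_ge0_pi//.
  by rewrite subr_ge0 sth' lerBlDr (le_trans thpi)// lerDl.
by rewrite s0 (le_trans sth').
Qed.

(** The antipode of x is reached through any third point z of C, which is antipodal to neither. *)
Lemma polytope_connected_or_antipodal C : connected (polytope_set C) \/
  exists x y, \val y = - \val x /\ polytope_set C = [set x; y].
Proof.
have [h|h] := pselect (exists x y, \val y = - \val x /\ polytope_set C = [set x; y]).
  by right.
left; have [[x Cx] _] := polytopeP C.
suff -> : polytope_set C = connected_component (polytope_set C) x.
  exact: component_connected.
apply/seteqP; split; last exact: connected_component_sub.
move=> y Cy; have [yx|] := eqVneq (\val y) (- \val x); last exact: polytope_component.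
have [z Cz [zx zy]] : exists2 z, polytope_set C z & z <> x /\ z <> y.
  apply: contrapT => nz; apply: h; exists x, y; split=> //.
  apply/seteqP; split=> [z Cz|z [|] ->]//.
  have [->|zx] := pselect (z = x); first by left.
  by right; apply: contrapT => zy; apply: nz; exists z.
apply: (@connected_component_trans _ _ z).
  apply: polytope_component => //; apply/eqP => zNx; apply: zy.
  by apply: val_inj; rewrite zNx yx.
apply: polytope_component => //; apply/eqP => yNz; apply: zx; apply: val_inj.
by apply: oppr_inj; rewrite -yNz yx.
Qed.

End PolytopesConnected.

Theorem theorem3p3 (R : realType) (d : nat) (hd : (2 <= d)%N)
    (nu : probability (hypersphere R d) R) (hnu : rotation_invariant nu)
    (kappa : probability (hypersphere R d) R) (hkappa : regular kappa)
    (T : tessellation R d)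
    (dO : measure_display) (Omega : measurableType dO)
    (P : probability Omega R) (Y : R -> Omega -> tessellation R d)
    (hY : splitting_process P Y kappa T) :
  [/\ (forall C : polytope R d,
         (exists! c : polytope R d, cells T c /\ C `<=` c°) ->
         forall t : R, 0 <= t ->
           avoid_proba P Y t C = (expR (- (fine (kappa (hits C)) * t)))%:E),
      (kappa `<< nu ->
         forall C : set (sphere R d), closed C -> connected C ->
         (exists2 c : polytope R d, cells T c & C `<=` c°) ->
         forall t : R, 0 <= t ->
           avoid_proba P Y t C = (expR (- (fine (kappa (hits C)) * t)))%:E) &
      ((forall B : set (hypersphere R d), measurable B -> kappa B = nu B) ->
         forall (x y : sphere R d) (C : set (sphere R d)),
         spherical_segment x y C -> geod x y <= pi ->
         (exists2 c : polytope R d, cells T c & C `<=` c°) ->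
         forall t : R, 0 <= t ->
           avoid_proba P Y t C = (expR (- (pi^-1 * geod x y * t)))%:E)].
Proof.
have d0 : (0 < d)%N := ltnW hd.
split.
- move=> C [c [[Tc Cc] _]] t t0.
  have Tc' : exists2 c : polytope R d, cells T c & polytope_set C `<=` c° by exists c.
  have [cC|[x [y [yx CE]]]] := polytope_connected_or_antipodal C.
    by apply: (avoid_connected hY d0) => //; exact: closed_polytope.
  by rewrite CE in Tc' *; exact: (avoid_antipodal hY d0 yx).
- by move=> _ C clC cC Tc t t0; exact: (avoid_connected hY d0).
- move=> kn x y C [v [vv xv _ CE]] xypi Tc t t0.
  (* The direction v that comes with the segment is kept, so for antipodal end points this is the
     given half-circle. *)
  have {}CE : C = circle_arc x v 0 (geod x y).
    rewrite CE; apply/seteqP; split=> z.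
      move=> [s s0 sz]; exists s; rewrite /= ?in_itv//.
      by apply: val_inj; rewrite val_great_circle.
    move=> [s + <-]; rewrite /= in_itv/= => s0.
    by exists s => //; rewrite val_great_circle.
  (* Regularity passes from [kappa] to [nu] because the hyperspheres through a point form a
     measurable set, namely those hitting a closed singleton. *)
  have nureg : regular nu.
    move=> e; have hE : [set S : hypersphere R d | (S : set _) e] = hits [set e].
      apply/seteqP; split=> [S Se|S [z [Sz ze]]]; first by exists e.
      by rewrite /= -ze.
    rewrite -kn ?hkappa// hE; apply: measurable_hits_closed => //.
    exact: closed_sphere1.
  rewrite (avoid_connected hY d0)//.
  + rewrite kn CE; last exact: measurable_hits_arc.
    rewrite (hits_arc_measure vv xv d0 hnu nureg) ?geod_ge0//.
    by rewrite [geod x y / pi]mulrC.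
  + by rewrite CE; exact: closed_arc.
  + by rewrite CE; exact: connected_arc.
Qed.
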